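(* In the setting of the context, assume moreover that $D$ has the finite norm property (i.e. $D/I$ is finite for every nonzero ideal $I$ of $D$). Then the number of polynomial functions $\mathcal{D}_{I_1}\times\cdots\times\mathcal{D}_{I_r}\to D/J$ equals $$N(I_1,\ldots,I_r;J)=\prod_{\mathbf{k}}\Big|\big(v_{k_1}(X_1)\cdots v_{k_r}(X_r)+\bar J\big)/\bar J\Big|,$$ where the product runs over all $\mathbf{k}=(k_1,\ldots,k_r)\in\mathbb{N}^r$ with $0\le k_i\le\mu(I_i,J)-1$ for each $1\le i\le r$.
   Context: $D$ is a Dedekind domain, $r\ge1$, and $I_1,\ldots,I_r,J$ are ideals of $D$ different from $0$ and $D$. For each $i$ a complete set of residues $\mathcal{D}_{I_i}\subseteq D$ modulo $I_i$ with $0\in\mathcal{D}_{I_i}$ is fixed, identified with $D/I_i$. Let $K=I_1\cap\cdots\cap I_r\cap J$, $R=D/K$, and $\bar I=I/K$ for ideals $I\supseteq K$, so $R/\bar J=D/J$. Let $X_i\subseteq R$ be the image of $\mathcal{D}_{I_i}$ in $R$. Write $K=P_1^{e_1}\cdots P_n^{e_n}$; the nonzero primes of $R$ are $\bar P_1,\ldots,\bar P_n$. For a nonzero prime $\bar P$ of $R$ and $a\in R$, $w_{\bar P}(a)$ is the highest power of $\bar P$ containing $a$ ($w_{\bar P}(0)=0$). A $\bar P$-ordering of $X\subseteq R$ is a sequence $b_0,b_1,\ldots$ in $X$, $b_0$ arbitrary, with each $b_k$ chosen to make $w_{\bar P}((b_k-b_0)\cdots(b_k-b_{k-1}))$ as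 large as possible; $v_0(X,\bar P)=R$, $v_k(X,\bar P)=w_{\bar P}((b_k-b_0)\cdots(b_k-b_{k-1}))$ for $k\ge1$ (independent of the ordering), and $v_k(X)=\prod_{l=1}^n v_k(X,\bar P_l)$. $\mu(I_i,J)$ is the smallest positive integer $k$ with $v_k(X_i)\subseteq\bar J$ if it exists, and $|D/I_i|$ otherwise. A function $f:\mathcal{D}_{I_1}\times\cdots\times\mathcal{D}_{I_r}\to D/J$ is a polynomial function if some $F\in D[x_1,\ldots,x_r]$ satisfies $F(b)\equiv f(b)\pmod J$ for all $b\in\mathcal{D}_{I_1}\times\cdots\times\mathcal{D}_{I_r}$. *)

(* Defs.v *)
From HB Require Import structures.
From mathcomp Require Import all_boot all_order all_algebra.
From Stdlib Require Import ClassicalEpsilon.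
Set Implicit Arguments. Unset Strict Implicit. Unset Printing Implicit Defensive.
Import Order.TTheory GRing.Theory Num.Theory.
Local Open Scope ring_scope.

Section Defs.
Variable D : idomainType.

Definition iset := D -> Prop.

Definition is_ideal (I : iset) : Prop :=
  [/\ I 0, (forall x y, I x -> I y -> I (x + y)) & (forall a x, I x -> I (a * x))].

Definition isub (I J : iset) : Prop := forall x, I x -> J x.
Definition ieq (I J : iset) : Prop := isub I J /\ isub J I.
Definition ifull : iset := fun _ => True.
Definition inonzero (I : iset) : Prop := exists x, I x /\ x != 0.
Definition iproper (I : iset) : Prop := ~ I 1.

Definition isum (I J : iset) : iset := fun x => exists a b, [/\ I a, J b & x = a + b].
Definition icap (I J : iset) : iset := fun x => I x /\ J x.
Definition imul (I J : iset) : iset := fun x =>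
  exists s : seq (D * D), (forall p, p \in s -> I p.1 /\ J p.2) /\
                          x = \sum_(p <- s) p.1 * p.2.
Fixpoint iexp (I : iset) (n : nat) : iset :=
  if n is n'.+1 then imul I (iexp I n') else ifull.
Definition iprod (s : seq iset) : iset := foldr imul ifull s.

Definition fin_gen (I : iset) : Prop :=
  exists s : seq D, forall x,
    I x <-> exists c : 'I_(size s) -> D, x = \sum_(i < size s) c i * s`_i.
Definition noetherian : Prop := forall I, is_ideal I -> fin_gen I.
Definition prime_ideal (P : iset) : Prop :=
  [/\ is_ideal P, iproper P & forall a b, P (a * b) -> P a \/ P b].
Definition maximal_ideal (M : iset) : Prop :=
  [/\ is_ideal M, iproper M &
      forall I, is_ideal I -> isub M I -> ieq I M \/ I 1].
Definition integrally_closed : Prop :=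
  forall x : {fraction D},
    (exists p : {poly D}, p \is monic /\ root (map_poly (@FracField.tofrac D) p) x) ->
    exists d : D, x = @FracField.tofrac D d.
Definition dedekind : Prop :=
  [/\ noetherian, integrally_closed &
      forall P, prime_ideal P -> inonzero P -> maximal_ideal P].

Definition has_nclasses (T : Type) (P : T -> Prop) (E : T -> T -> Prop) (n : nat) : Prop :=
  exists s : 'I_n -> T,
    [/\ forall i, P (s i), (forall i j, E (s i) (s j) -> i = j)
      & forall x, P x -> exists i, E x (s i)].

Definition congr_mod (J : iset) : D -> D -> Prop := fun x y => J (x - y).

Definition qcard (A J : iset) : nat :=
  epsilon (inhabits 0%N) (fun n => has_nclasses A (congr_mod J) n).

Definition finite_norm : Prop :=
  forall I, is_ideal I -> inonzero I -> exists n, has_nclasses ifull (congr_mod I) n.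

Definition residue_set (I : iset) (Ds : seq D) : Prop :=
  [/\ 0 \in Ds, (forall x, exists2 d, d \in Ds & I (x - d))
    & forall d d', d \in Ds -> d' \in Ds -> I (d - d') -> d = d'].

(** Ideals of R = D/K are represented by ideals of D containing K;
    elements of R by representatives in D. *)

(** w_{\bar P}(a): K (the zero ideal of R) if a = 0 in R, otherwise the
    highest power (\bar P^m = (P^m + K)/K) containing a, i.e. the smallest
    among the (nested) powers of \bar P containing a. *)
Definition wP (K P : iset) (a : D) : iset := fun x =>
  (K a -> K x) /\
  (~ K a -> forall m, isum (iexp P m) K a -> isum (iexp P m) K x).

Definition diffprod (b : nat -> D) (k : nat) (x : D) : D := \prod_(j < k) (x - b j).

(** \bar P-ordering of X (X given by representatives in D). "As large as
    possible" = maximal for inclusion among the ideals w(...). *)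
Definition is_Pordering (K P : iset) (X : D -> Prop) (b : nat -> D) : Prop :=
  (forall k, X (b k)) /\
  forall k, (0 < k)%N -> forall x, X x ->
    isub (wP K P (diffprod b k x)) (wP K P (diffprod b k (b k))).

Definition vkP (K P : iset) (X : D -> Prop) (k : nat) : iset :=
  if k is 0 then ifull else
  epsilon (inhabits ifull)
    (fun I => exists b, is_Pordering K P X b /\ I = wP K P (diffprod b k (b k))).

Definition vk (K : iset) (Ps : seq iset) (X : D -> Prop) (k : nat) : iset :=
  isum (iprod [seq vkP K P X k | P <- Ps]) K.

Definition mu_ideal (K : iset) (Ps : seq iset) (X : D -> Prop) (I J : iset) : nat :=
  epsilon (inhabits 0%N) (fun m =>
    ((exists k, (0 < k)%N /\ isub (vk K Ps X k) J) /\
       [/\ (0 < m)%N, isub (vk K Ps X m) J &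
           forall k, (0 < k)%N -> isub (vk K Ps X k) J -> (m <= k)%N])
    \/ (~ (exists k, (0 < k)%N /\ isub (vk K Ps X k) J) /\ m = qcard ifull I)).

Definition mpoly (r : nat) := seq (D * {ffun 'I_r -> nat}).
Definition meval (r : nat) (F : mpoly r) (b : 'I_r -> D) : D :=
  \sum_(t <- F) t.1 * \prod_(i < r) b i ^+ t.2 i.

Definition same_polyfun (r : nat) (Ds : 'I_r -> seq D) (J : iset) (F G : mpoly r) : Prop :=
  forall b : 'I_r -> D, (forall i, b i \in Ds i) -> J (meval F b - meval G b).

End Defs.

(* Main.v *)
(** Localizing at each prime [P l] containing [K], [D] becomes a discrete
    valuation ring, so [D / K] carries valuations [vt l] cut off at the exponent
    of [P l] in [K], and an ideal containing [K] is described by one level for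
    each [l].  For every [l] a P-ordering of [X_i] gives Newton polynomials; since
    the k-th one vanishes modulo [P l] to exactly the order of [v_k] at the k-th
    point of the ordering, a triangular elimination shows that a combination of
    Newton polynomials has level at least [N] on [X_i] iff each of its terms has.
    This makes [v_k] independent of the ordering.  The Chinese remainder theorem
    merges the orderings for all [l] into one sequence in [D].  In the products
    of the resulting Newton polynomials with [k_i < mu i], every polynomial
    function has coefficients [c_k], and each [c_k] is determined exactly modulo
    [(J : v_k1 ... v_kr)], whose index is that of [J] in [v_k1 ... v_kr + J]. *)

Require Import Defs.
From HB Require Import structures.
From mathcomp Require Import all_boot all_order all_algebra.
From mathcomp Require Import ring zify.
From Stdlib Require Import ClassicalEpsilon.
Set Implicit Arguments. Unset Strict Implicit. Unset Printing Implicit Defensive.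
Import Order.TTheory GRing.Theory Num.Theory.
Local Open Scope ring_scope.

(** * Adic valuations of a Dedekind domain *)

Section Ideals.
Variable D : idomainType.
Implicit Types (A B P : iset D).

Lemma ideal0 A : is_ideal A -> A 0. Proof. by case. Qed.
Lemma idealD A x y : is_ideal A -> A x -> A y -> A (x + y).
Proof. by case=> _ h _; exact: h. Qed.
Lemma idealMl A a x : is_ideal A -> A x -> A (a * x).
Proof. by case=> _ _; exact. Qed.
Lemma idealMr A a x : is_ideal A -> A x -> A (x * a).
Proof. by move=> hA hx; rewrite mulrC; exact: idealMl. Qed.
Lemma idealN A x : is_ideal A -> A x -> A (- x).
Proof. by move=> hA hx; rewrite -mulN1r; exact: idealMl. Qed.
Lemma idealB A x y : is_ideal A -> A x -> A y -> A (x - y).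
Proof. by move=> hA hx hy; apply: idealD => //; exact: idealN. Qed.
Lemma idealBC A x y : is_ideal A -> A (x - y) -> A (y - x).
Proof. by move=> hA h; rewrite -opprB; exact: idealN. Qed.
Lemma idealBT A x y z : is_ideal A -> A (x - y) -> A (y - z) -> A (x - z).
Proof. by move=> hA h1 h2; rewrite -(subrKA y); exact: idealD. Qed.

Lemma ideal_sum A (T : Type) (s : seq T) (Q : pred T) (F : T -> D) :
  is_ideal A -> (forall i, Q i -> A (F i)) -> A (\sum_(i <- s | Q i) F i).
Proof.
move=> hA h; elim/big_ind: _ => //; first exact: ideal0.
by move=> x y; exact: idealD.
Qed.

Lemma ideal_isum A B : is_ideal A -> is_ideal B -> is_ideal (isum A B).
Proof.
move=> hA hB; split.
- by exists 0, 0; split; rewrite ?addr0 //; exact: ideal0.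
- move=> _ _ [a [b [ha hb ->]]] [a' [b' [ha' hb' ->]]]; exists (a + a'), (b + b').
  by split; [exact: idealD|exact: idealD|rewrite addrACA].
- move=> c _ [a [b [ha hb ->]]]; exists (c * a), (c * b).
  by split; [exact: idealMl|exact: idealMl|rewrite mulrDr].
Qed.

Definition principal (a : D) : iset D := fun x => exists t, x = a * t.

Lemma principal_ideal a : is_ideal (principal a).
Proof.
split.
- by exists 0; rewrite mulr0.
- by move=> _ _ [t ->] [u ->]; exists (t + u); rewrite mulrDr.
- by move=> c _ [t ->]; exists (c * t); rewrite mulrCA.
Qed.

Lemma prime_mul_notin P a b : prime_ideal P -> ~ P a -> ~ P b -> ~ P (a * b).
Proof. by case=> _ _ h ha hb /h []. Qed.

Lemma prime_exp_notin P a m : prime_ideal P -> ~ P a -> ~ P (a ^+ m).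
Proof.
move=> hP ha; elim: m => [|m IH]; first by rewrite expr0; case: hP.
by rewrite exprS; exact: prime_mul_notin.
Qed.

Lemma prime_prod_notin P (T : Type) (s : seq T) (Q : pred T) (F : T -> D) :
  prime_ideal P -> (forall i, Q i -> ~ P (F i)) -> ~ P (\prod_(i <- s | Q i) F i).
Proof.
move=> hP h; elim/big_ind: _ => //; first by case: hP.
by move=> x y; exact: prime_mul_notin.
Qed.

(** Two of the [n.+1] terms [f 0, ..., f n] fall in one class modulo [A]. The gap is written [k.+1]
    so that it is visibly positive when [f] is a sequence of powers. *)
Lemma quotient_pigeonhole A n (f : nat -> D) :
  is_ideal A -> has_nclasses (@ifull D) (congr_mod A) n ->
  exists i k, A (f i - f (i + k.+1)%N).
Proof.
move=> hA [s [_ _ hs]].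
have /choice [g hg] : forall k : nat, exists i, A (f k - s i) by move=> k; exact: hs.
have /injectivePn [x [y nxy exy]] : ~~ injectiveb (fun k : 'I_n.+1 => g k).
  by apply/negP => /injectiveP/leq_card; rewrite !card_ord ltnn.
wlog ltxy : x y nxy exy / (x < y)%N.
  move=> W; case: (ltngtP x y) => [l|l|e]; first exact: (W x y).
    by apply: (W y x) => //; rewrite eq_sym.
  by move/eqP: nxy; case; exact: val_inj.
exists x, (y - x).-1; rewrite prednK ?subn_gt0 // subnKC ?(ltnW ltxy) //.
apply: (@idealBT A _ (s (g x))) => //; rewrite exy.
exact/(idealBC hA)/hg.
Qed.

(** The powers of [y] repeat modulo [A], so [A] contains [(1 - y ^+ k.+1) * y ^+ i], and the first
    factor is outside [P] because [y] is in [P]. *)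
Lemma locally_nilpotent A P n y :
  is_ideal A -> has_nclasses (@ifull D) (congr_mod A) n -> prime_ideal P -> P y ->
  exists s m, ~ P s /\ A (s * y ^+ m).
Proof.
move=> hA hn [hP P1 _] Py.
have [i [k h]] := quotient_pigeonhole (fun k => y ^+ k) hA hn.
exists (1 - y ^+ k.+1), i; split; last by rewrite mulrBl mul1r -exprD addnC.
move=> h'; apply: P1; rewrite -(subrK (y ^+ k.+1) 1); apply: idealD => //.
by rewrite exprS; exact: idealMr.
Qed.

(** With [A] the principal ideal of [a] and [ys] generating [P], the fraction [b / a] maps [P] into
    [D] without lying in [D]. To find [b], start from an element outside [P] that sends some power
    of each [y] into [A], then multiply by powers of the [y] as long as the product stays outside
    [A]. *)
Lemma associated_element A P n (ys : seq D) :
  is_ideal A -> has_nclasses (@ifull D) (congr_mod A) n -> prime_ideal P ->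
  isub A P -> (forall y, y \in ys -> P y) ->
  exists b, ~ A b /\ forall y, y \in ys -> A (b * y).
Proof.
move=> hA hn hP AP hys.
have [b0 [b0P hb0]] : exists b, ~ P b /\ forall y, y \in ys -> exists m, A (b * y ^+ m).
  elim: ys hys => [|y ys IH] hys; first by exists 1; split => //; case: hP.
  have [|b [bP hb]] := IH; first by move=> z zs; apply: hys; rewrite inE zs orbT.
  have [|s [m [sP hs]]] := locally_nilpotent hA hn hP (y := y).
    by apply: hys; rewrite mem_head.
  exists (b * s); split; first exact: prime_mul_notin.
  move=> z; rewrite inE => /orP [/eqP ->|/hb [k hk]].
    by exists m; rewrite -mulrA; exact: idealMl.
  by exists k; rewrite mulrAC; exact: idealMr.
suff [c [hc1 hc2]] : exists c, ~ A (b0 * c) /\ forall y, y \in ys -> A (b0 * c * y).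
  by exists (b0 * c).
elim: ys hb0 {hys} => [|y ys IH] hb0.
  by exists 1; rewrite mulr1; split => // /AP.
have [|c [hc1 hc2]] := IH; first by move=> z zs; apply: hb0; rewrite inE zs orbT.
have [|m hm] := hb0 y; first by rewrite mem_head.
(* The last power of [y] that keeps the product outside [A]. *)
have [k [hk1 hk2]] : exists k, ~ A (b0 * c * y ^+ k) /\ A (b0 * c * y ^+ k.+1).
  have {hm} : A (b0 * c * y ^+ m) by rewrite mulrAC; exact: idealMr.
  elim: m => [|m IHm] h; first by rewrite mulr1 in h.
  by case: (classic (A (b0 * c * y ^+ m))) => h'; [exact: IHm|exists m].
exists (c * y ^+ k); rewrite mulrA; split => // z.
rewrite inE => /orP [/eqP ->|zs]; first by rewrite -mulrA -exprSr.
by rewrite mulrAC; apply: idealMr => //; exact: hc2.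
Qed.

(* An element [b / a] of the fraction field mapping a nonzero finitely
   generated ideal into itself is integral. *)
Lemma stabilizer_integral P a b :
  integrally_closed D -> fin_gen P -> inonzero P -> a != 0 ->
  (forall y, P y -> exists2 t, P t & b * y = a * t) -> principal a b.
Proof.
move=> hcl [s hs] [p [Pp p0]] a0 hst.
have Ps i : (i < size s)%N -> P s`_i.
  move=> lt; apply/hs; exists (fun j : 'I_(size s) => (j == Ordinal lt)%:R).
  rewrite (bigD1 (Ordinal lt)) //= eqxx mul1r big1 ?addr0 // => j /negPf ->.
  by rewrite mul0r.
have /choice [C hC] : forall i : 'I_(size s), exists c : 'I_(size s) -> D,
    b * s`_i = a * \sum_j c j * s`_j.
  by move=> i; have [t /hs [c ->] e] := hst _ (Ps i (ltn_ord i)); exists c.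
(* The row of generators is a nonzero eigenvector for [b / a], which is thus a root of a monic
   characteristic polynomial over [D]. The indices of [C] are swapped because eigenvectors are
   rows. *)
pose M : 'M[D]_(size s) := \matrix_(i, j) C j i.
pose fr := @FracField.tofrac D.
have fa0 : fr a != 0 by rewrite /fr tofrac_eq0.
have ev : eigenvalue (map_mx fr M) (fr b / fr a).
  apply/eigenvalueP; exists (\row_j fr s`_j).
    apply/rowP => j; rewrite !mxE.
    apply: (mulfI fa0); rewrite mulrA mulrCA mulfV // mulr1.
    rewrite -rmorphM /= hC rmorphM rmorph_sum /=; congr (_ * _).
    by apply: eq_bigr => i _; rewrite !mxE rmorphM mulrC.
  apply/eqP => /rowP e; case/eqP: p0; have [c ->] := (hs p).1 Pp.
  apply: big1 => i _; have := e i; rewrite !mxE => /eqP.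
  by rewrite tofrac_eq0 => /eqP ->; rewrite mulr0.
have [|d hd] := hcl (fr b / fr a).
  exists (char_poly M); split; first exact: char_poly_monic.
  by rewrite map_char_poly -eigenvalue_root_char.
exists d; apply/eqP; rewrite -tofrac_eq rmorphM /=; apply/eqP.
by rewrite -hd mulrC divfK.
Qed.

(* [P] is principal in the localization at [P], which is therefore a discrete
   valuation ring. *)
Lemma prime_locally_principal P :
  dedekind D -> finite_norm D -> prime_ideal P -> inonzero P ->
  exists p z, [/\ P p, p != 0, ~ P z & forall y, P y -> exists t, z * y = p * t].
Proof.
move=> [hN hcl _] hfin hP hP0; have [idP _ _] := hP.
have [a [Pa a0]] := hP0.
have fgP := hN _ idP; have [s hs] := fgP.
have Ps y : y \in s -> P y.
  move=> ys; have lt : (index y s < size s)%N by rewrite index_mem.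
  apply/hs; exists (fun j : 'I_(size s) => (j == Ordinal lt)%:R).
  rewrite (bigD1 (Ordinal lt)) //= eqxx mul1r nth_index // big1 ?addr0 //.
  by move=> j /negPf ->; rewrite mul0r.
have idA := principal_ideal a.
have [|n hn] := hfin _ idA; first by exists a; split => //; exists 1; rewrite mulr1.
have [|b [nAb hb]] := associated_element idA hn hP _ Ps.
  by move=> _ [t ->]; exact: idealMr.
have hbP y : P y -> principal a (b * y).
  move/hs => [c ->]; rewrite mulr_sumr; apply: ideal_sum => [//|i _].
  by rewrite mulrCA; apply: idealMl => //; apply: hb; exact: mem_nth.
(* Otherwise [b / a] would map [P] into itself, hence be integral and lie in [D]. Cross-multiplying
   [b * p = a * z] with [b * y = a * t] then gives [z * y = p * t]. *)
have [p [Pp [z [ez Pz]]]] : exists p, P p /\ exists z, b * p = a * z /\ ~ P z.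
  apply: NNPP => hno; apply: nAb; apply: (stabilizer_integral hcl fgP hP0 a0).
  move=> y Py; have [t e] := hbP y Py; exists t => //.
  by apply: NNPP => Pt; apply: hno; exists y; split => //; exists t.
have b0 : b != 0 by apply/eqP => b0; apply: nAb; rewrite b0; exact: ideal0.
exists p, z; split => //.
  apply/eqP => p0; move: ez; rewrite p0 mulr0 => /esym/eqP.
  by rewrite mulf_eq0 (negPf a0) /= => /eqP z0; apply: Pz; rewrite z0; exact: ideal0.
move=> y Py; have [t et] := hbP y Py; exists t.
apply: (mulfI a0); apply: (mulfI b0).
transitivity ((a * z) * (b * y)); first by ring.
by rewrite -ez et; ring.
Qed.

(** * Powers of a prime and its adic valuation *)

Lemma ideal_imul A B : is_ideal A -> is_ideal (imul A B).
Proof.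
move=> hA; split.
- by exists [::]; split => //; rewrite big_nil.
- move=> _ _ [s [hs ->]] [t [ht ->]]; exists (s ++ t); split; last by rewrite big_cat.
  by move=> q; rewrite mem_cat => /orP [/hs|/ht].
- move=> c _ [s [hs ->]]; exists [seq (c * q.1, q.2) | q <- s]; split.
    by move=> _ /mapP [q /hs [h1 h2] ->]; split => //; exact: idealMl.
  by rewrite big_map mulr_sumr; apply: eq_bigr => q _; rewrite mulrA.
Qed.

Lemma mem_imul A B a b : A a -> B b -> imul A B (a * b).
Proof.
move=> ha hb; exists [:: (a, b)]; split; last by rewrite big_seq1.
by move=> q; rewrite inE => /eqP ->.
Qed.

Lemma imul_sub A B C : is_ideal C -> (forall a b, A a -> B b -> C (a * b)) ->
  isub (imul A B) C.
Proof.
move=> hC h _ [s [hs ->]]; rewrite big_seq.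
by apply: ideal_sum => // q /hs [h1 h2]; exact: h.
Qed.

Lemma ideal_iexp P m : is_ideal P -> is_ideal (iexp P m).
Proof. by move=> hP; case: m => [|m] //=; exact: ideal_imul. Qed.

Lemma mem_iexp P m y : P y -> iexp P m (y ^+ m).
Proof. by move=> hy; elim: m => [|m IH] //=; rewrite exprS; exact: mem_imul. Qed.

Lemma prime_maximal P : dedekind D -> prime_ideal P -> inonzero P ->
  forall s, ~ P s -> exists d, P (1 - s * d).
Proof.
move=> [_ _ hmax] hP hP0 s Ps; have [idP P1 hmx] := hmax _ hP hP0.
have idI := ideal_isum (principal_ideal s) idP.
have [|[h1 h2]|[_ [y [[d ->] Py e]]]] := hmx _ idI.
- by move=> x Px; exists 0, x; split; rewrite ?add0r //; exact: (ideal0 (principal_ideal s)).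
- case: Ps; apply: h1; exists s, 0; rewrite addr0; split => //; last exact: ideal0.
  by exists 1; rewrite mulr1.
- by exists d; rewrite e addrC addKr.
Qed.

(* [v] is the [P]-adic valuation; its value at [0] is unspecified.  In the last
   field, [s] is a denominator of [x / a] prime to [P]. *)
Record adic_valuation P (v : D -> nat) : Prop := AdicValuation {
  valM : forall x y, x != 0 -> y != 0 -> v (x * y) = (v x + v y)%N;
  val_iexp : forall m x, iexp P m x <-> x = 0 \/ (m <= v x)%N;
  val_mem : forall x, P x <-> x = 0 \/ (0 < v x)%N;
  val_uniformizer : exists2 p, p != 0 & v p = 1%N;
  val_frac : forall a x, a != 0 -> x != 0 -> (v a <= v x)%N ->
    exists s w, ~ P s /\ s * x = w * a
}.

(** In the localization at [P] every nonzero [x] is a unit times a power of the uniformizer [p].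
    Cleared of denominators this reads [s * x = p ^+ m * t] with [s] and [t] outside [P], and [v x]
    is this [m]. *)
Lemma adic_valuation_exists P : dedekind D -> finite_norm D ->
  prime_ideal P -> inonzero P -> exists v, adic_valuation P v.
Proof.
move=> hD hfin hP hP0; have [idP P1 hprime] := hP.
have [p [z [Pp p0 Pz hz]]] := prime_locally_principal hD hfin hP hP0.
have pX m : p ^+ m != 0 by rewrite expf_neq0.
have ex x : x != 0 -> exists m s t, [/\ ~ P s, ~ P t & s * x = p ^+ m * t].
  move=> x0; apply: NNPP => hno.
  (* Without such a form, every power of [p] divides [x] locally. But two powers of [p] agree modulo
     [x], so [x] divides [p ^+ i * (1 - p ^+ k.+1)]; divisibility of [x] by [p ^+ i.+1] then forces
     a product of two elements outside [P] into [P]. *)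
  have hV m : exists s t, ~ P s /\ s * x = p ^+ m * t.
    elim: m => [|m [s [t [Ps e]]]]; first by exists 1, x; rewrite expr0.
    have Pt : P t by apply: NNPP => Pt; apply: hno; exists m, s, t.
    have [t' et] := hz t Pt; exists (z * s), t'; split; first exact: prime_mul_notin.
    by rewrite -mulrA e mulrCA et exprSr mulrA.
  have [|n hn] := hfin _ (principal_ideal x).
    by exists x; split => //; exists 1; rewrite mulr1.
  have [i [k [w hw]]] := quotient_pigeonhole (fun k => p ^+ k) (principal_ideal x) hn.
  have [s [t [Ps e]]] := hV i.+1.
  have e2 : s * (1 - p ^+ k.+1) = p * (t * w).
    apply: (mulfI (pX i)); transitivity (s * (p ^+ i - p ^+ (i + k.+1))).
      by rewrite exprD; ring.
    by rewrite hw mulrA e exprS; ring.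
  have : P (s * (1 - p ^+ k.+1)) by rewrite e2; exact: idealMr.
  case/hprime => // h; apply: P1; rewrite -(subrK (p ^+ k.+1) 1).
  by apply: idealD => //; rewrite exprS; exact: idealMr.
(* An exponent whose cofactor [t] is outside [P] bounds every other exponent, which makes [v x] well
   defined. *)
have lem m m' x s s' t t' : ~ P s -> ~ P t -> s * x = p ^+ m * t ->
    s' * x = p ^+ m' * t' -> ~ P s' -> x != 0 -> (m' <= m)%N.
  move=> Ps Pt e e' Ps' x0; rewrite leqNgt; apply/negP => lt.
  have : P (s' * t).
    have -> : s' * t = p * (p ^+ (m' - m).-1 * (s * t')).
      apply: (mulfI (pX m)); transitivity (s' * (s * x)); first by rewrite e; ring.
      rewrite mulrCA e' -{1}(subnKC (ltnW lt)) exprD -{1}(prednK (n := (m' - m))) ?subn_gt0 //.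
      by rewrite exprS; ring.
    exact: idealMr.
  exact: prime_mul_notin.
have /choice [v hv] : forall x, exists m, x != 0 ->
    exists s t, [/\ ~ P s, ~ P t & s * x = p ^+ m * t].
  move=> x; case: (eqVneq x 0) => [->|/ex [m h]]; first by exists 0%N.
  by exists m.
have vle m x s t : x != 0 -> ~ P s -> s * x = p ^+ m * t -> (m <= v x)%N.
  by move=> x0 Ps e; have [s' [t' [h1 h2 h3]]] := hv x x0; exact: (lem _ _ x s' s t' t).
have veq m x s t : x != 0 -> ~ P s -> ~ P t -> s * x = p ^+ m * t -> v x = m.
  move=> x0 Ps Pt e; apply/eqP; rewrite eqn_leq (vle _ _ _ _ x0 Ps e) andbT.
  by have [s' [t' [h1 h2 h3]]] := hv x x0; exact: (lem _ _ x s s' t t').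
have viexp m x : iexp P m x <-> x = 0 \/ (m <= v x)%N.
  split => [h|[->|h]]; last 2 first.
  - exact: ideal0 (ideal_iexp m idP).
  - case: (eqVneq x 0) => [->|x0]; first exact: ideal0 (ideal_iexp m idP).
    have [s [t [Ps Pt e]]] := hv x x0.
    (* Since [s] is invertible modulo [P], [y = 1 - s * d] is in [P]. Then [x * y ^+ m] is in the
       [m]-th power of [P], and [x - x * y ^+ m] is a multiple of [s * x], which is there too. *)
    have [d hd] := prime_maximal hD hP hP0 Ps.
    set y := 1 - s * d in hd.
    have : iexp P m (s * x).
      rewrite e -(subnKC h) exprD -mulrA.
      by apply: idealMr; [exact: ideal_iexp|exact: mem_iexp].
    move=> hsx; rewrite -(subrK (x * y ^+ m) x).
    apply: (idealD (ideal_iexp m idP)); last first.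
      by apply: idealMl; [exact: ideal_iexp|exact: mem_iexp].
    have -> : x - x * y ^+ m = (s * x) * (d * \sum_(i < m) y ^+ i).
      have := subrX1 y m; have -> : y - 1 = - (s * d) by rewrite /y; ring.
      move=> e1; transitivity (- (x * (y ^+ m - 1))); first by ring.
      by rewrite e1; ring.
    by apply: idealMr => //; exact: ideal_iexp.
  suff : exists s t, ~ P s /\ s * x = p ^+ m * t.
    move=> [s [t [Ps e]]]; case: (eqVneq x 0) => [->|x0]; [by left|right].
    exact: vle e.
  elim: m x h => [|m IH] x; first by exists 1, x; rewrite expr0.
  pose C : iset D := fun x => exists s t, ~ P s /\ s * x = p ^+ m.+1 * t.
  have idC : is_ideal C.
    split.
    - by exists 1, 0; rewrite !mulr0.
    - move=> a b [s [t [Ps e]]] [s' [t' [Ps' e']]]; exists (s * s'), (s' * t + s * t').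
      split; first exact: prime_mul_notin.
      transitivity (s' * (s * a) + s * (s' * b)); first by ring.
      by rewrite e e'; ring.
    - move=> c a [s [t [Ps e]]]; exists s, (c * t); split => //.
      by rewrite mulrCA e; ring.
  apply: (imul_sub idC) => a b Pa /IH [s [t [Ps e]]].
  have [u eu] := hz a Pa; exists (z * s), (u * t); split; first exact: prime_mul_notin.
  transitivity ((z * a) * (s * b)); first by ring.
  by rewrite eu e exprS; ring.
exists v; split.
- move=> x y x0 y0; have [s [t [Ps Pt e]]] := hv x x0.
  have [s' [t' [Ps' Pt' e']]] := hv y y0.
  apply: (veq _ _ (s * s') (t * t')); try exact: prime_mul_notin.
    by rewrite mulf_neq0.
  transitivity ((s * x) * (s' * y)); first by ring.
  by rewrite e e' exprD; ring.
- exact: viexp.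
- move=> x; rewrite -viexp; split => [h|].
    by rewrite -(mulr1 x); exact: mem_imul.
  by apply: imul_sub => // a b Pa _; exact: idealMr.
- by exists p => //; apply: (veq _ _ 1 1); rewrite ?mul1r ?mulr1.
- move=> a x a0 x0 le; have [s [t [Ps Pt e]]] := hv x x0.
  have [s' [t' [Ps' Pt' e']]] := hv a a0.
  exists (s * t'), (s' * p ^+ (v x - v a) * t); split; first exact: prime_mul_notin.
  transitivity (t' * (s * x)); first by ring.
  rewrite e -{1}(subnKC le) exprD.
  transitivity ((p ^+ v a * t') * (p ^+ (v x - v a) * t)); first by ring.
  by rewrite -e'; ring.
Qed.

Lemma ex_least (Q : nat -> Prop) :
  (exists m, Q m) -> exists m, Q m /\ forall k, Q k -> (m <= k)%N.
Proof.
move=> [m hm]; elim/ltn_ind: m hm => m IH hm.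
case: (classic (exists2 k, (k < m)%N & Q k)) => [[k lt hk]|hno]; first exact: IH hk.
by exists m; split=> // k hk; rewrite leqNgt; apply/negP => lt; apply: hno; exists k.
Qed.

(** Among the ideals over [B] that avoid [1], take one containing the most of the finitely many
    representatives modulo [K]. Adjoining an element [a] outside it adds the representative of [a],
    so the larger ideal must contain [1]; primality follows. *)
Lemma maximal_over K n B : has_nclasses (@ifull D) (congr_mod K) n ->
  is_ideal B -> isub K B -> ~ B 1 -> exists M, prime_ideal M /\ isub B M.
Proof.
move=> [s [_ _ hs]] idB KB B1.
pose S (A : iset D) : {set 'I_n} :=
  [set i | if excluded_middle_informative (A (s i)) then true else false].
have inS A i : reflect (A (s i)) (i \in S A).
  rewrite inE; case: excluded_middle_informative => h; [exact: ReflectT|exact: ReflectF].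
pose good A := [/\ is_ideal A, isub B A & ~ A 1].
have [|m [[M [[idM BM M1] eM]] hmin]] :=
    @ex_least (fun m => exists A, good A /\ m = (n - #|S A|)%N).
  by exists (n - #|S B|)%N, B; split => //; split.
exists M; split => //; split => // a b Mab.
case: (classic (M a)) => [|Ma]; [by left|right].
have idA := ideal_isum idM (principal_ideal a).
have MA : isub M (isum M (principal a)).
  by move=> x Mx; exists x, 0; rewrite addr0; split=> //; exact: ideal0 (principal_ideal a).
case: (classic (isum M (principal a) 1)) => [[x [_ [Mx [c ->] e]]]|A1].
  rewrite -(mulr1 b) e mulrDr; apply: idealD => //; first exact: idealMl.
  by rewrite mulrA [b * a]mulrC; exact: idealMr.
have := hmin _ (ex_intro _ (isum M (principal a)) (conj (And3 idA (fun x h => MA x (BM x h)) A1) erefl)).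
rewrite eM leq_subLR => le.
have [i /KB/BM hi] := hs a I.
have : (#|S M| < #|S (isum M (principal a))|)%N.
  apply: proper_card; apply/properP; split.
    by apply/subsetP => j /inS hj; apply/inS; exact: MA.
  exists i.
    apply/inS; rewrite -(subKr a (s i)) addrC; exists (- (a - s i)), a.
    by split=> //; [exact: idealN|exists 1; rewrite mulr1].
  by apply/inS => h; apply: Ma; rewrite -(subrK (s i) a); exact: idealD.
have := max_card (S (isum M (principal a))); rewrite card_ord.
by lia.
Qed.

End Ideals.

(** * Cut-off valuations *)

(* Valuations on [D / K]: the [P l]-adic valuation of [D], cut off at the
   exponent [e l] of [P l] in [K]. *)
Record cut_valuations (D : idomainType) (K : iset D) n (P : 'I_n -> iset D)
    (e : 'I_n -> nat) (vt : 'I_n -> D -> nat) : Prop := CutValuations {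
  cv_le : forall l x, (vt l x <= e l)%N;
  cv0 : forall l, vt l 0 = e l;
  cv1 : forall l, vt l 1 = 0%N;
  cvM : forall l x y, vt l (x * y) = minn (e l) (vt l x + vt l y);
  cvD : forall l x y, (minn (vt l x) (vt l y) <= vt l (x + y)%R)%N;
  cvK : forall x, K x <-> forall l, vt l x = e l;
  cv_sub : forall B x, is_ideal B -> isub K B ->
    (forall l, exists2 y, B y & (vt l y <= vt l x)%N) -> B x;
  cv_crt : forall x : 'I_n -> D, exists y, forall l, vt l (y - x l) = e l;
  cv_exact : forall m : 'I_n -> nat, (forall l, m l <= e l)%N ->
    exists x, forall l, vt l x = m l;
  cv_iexp : forall l m x, isum (iexp (P l) m) K x <-> (minn m (e l) <= vt l x)%N
}.

Section CutValuations.
Variables (D : idomainType) (K : iset D) (n : nat) (P : 'I_n -> iset D).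
Hypotheses (hD : dedekind D) (hfin : finite_norm D).
Hypotheses (idK : is_ideal K) (K0 : inonzero K).
Hypothesis hP : forall l, [/\ prime_ideal (P l), inonzero (P l) & isub K (P l)].
Hypothesis P_complete : forall Q, prime_ideal Q -> inonzero Q -> isub K Q ->
  exists l, ieq Q (P l).
Hypothesis P_distinct : forall l l', ieq (P l) (P l') -> l = l'.

(** A proper ideal over [K] lies in a prime over [K], which is one of the [P l]. This passes from
    local conditions to global membership. *)
Lemma local_unit B : is_ideal B -> isub K B ->
  (forall l, exists2 s, B s & ~ P l s) -> B 1.
Proof.
move=> idB KB h; apply: NNPP => B1; have [N hN] := hfin idK K0.
have [M [pM BM]] := maximal_over hN idB KB B1.
have [||l [Ml _]] := P_complete pM; first by case: K0 => x [Kx x0]; exists x; auto.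
  by move=> x /KB/BM.
by have [s /BM/Ml] := h l.
Qed.

(** An inclusion of [P l] in [P m] would be an equality, by maximality of [P l]. *)
Lemma distinct_primes_separated l m : l != m -> exists2 c, P l c & ~ P m c.
Proof.
move=> nlm; apply: NNPP => hno; have [pl nl _] := hP l; have [[idm m1 _] _ _] := hP m.
have sub : isub (P l) (P m).
  by move=> c Pc; apply: NNPP => Pmc; apply: hno; exists c.
case/eqP: nlm; apply: P_distinct; split=> // s Pms; apply: NNPP => Pls.
have [d /sub hd] := prime_maximal hD pl nl Pls.
by apply: m1; rewrite -(subrK (s * d) 1); apply: idealD => //; exact: idealMr.
Qed.

Lemma cut_valuations_exist : exists e vt, cut_valuations K P e vt.
Proof.
have /choice [v hv] : forall l, exists v, adic_valuation (P l) v.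
  by move=> l; have [h1 h2 _] := hP l; exact: adic_valuation_exists.
(* The exponent of [P l] in [K] is the least valuation of a nonzero element of [K]. *)
have /choice [e he] : forall l, exists m, (exists k, [/\ K k, k != 0 & v l k = m]) /\
    forall x, K x -> x != 0 -> (m <= v l x)%N.
  move=> l; have [|m [h1 h2]] := @ex_least (fun m => exists k, [/\ K k, k != 0 & v l k = m]).
    by case: K0 => x [Kx x0]; exists (v l x), x.
  by exists m; split => // x Kx x0; apply: h2; exists x.
pose vt l x := if x == 0 then e l else minn (e l) (v l x).
have vtE l x : x != 0 -> vt l x = minn (e l) (v l x) by rewrite /vt => /negPf ->.
have vt_le l x : (vt l x <= e l)%N.
  by rewrite /vt; case: eqP => // _; exact: geq_minl.
have vt0 l : vt l 0 = e l by rewrite /vt eqxx.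
have v_notin l x : ~ P l x -> v l x = 0%N.
  move=> h; apply/eqP; rewrite -leqn0 leqNgt; apply/negP => lt.
  by apply/h/(val_mem (hv l)); right.
have vt_notin l x : ~ P l x -> vt l x = 0%N.
  move=> h; rewrite vtE ?(v_notin l x h) ?minn0 //; apply/eqP => x0.
  by apply/h/(val_mem (hv l)); left.
have vt1 l : vt l 1 = 0%N by apply: vt_notin; have [[]] := hP l.
have vtM l x y : vt l (x * y) = minn (e l) (vt l x + vt l y).
  have [->|x0] := eqVneq x 0.
    by rewrite mul0r vt0; apply/esym/minn_idPl; exact: leq_addr.
  have [->|y0] := eqVneq y 0.
    by rewrite mulr0 vt0; apply/esym/minn_idPl; exact: leq_addl.
  by rewrite !vtE ?mulf_neq0 // (valM (hv l)) //; lia.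
have vt_iexp l m x : (m <= e l)%N -> iexp (P l) m x <-> (m <= vt l x)%N.
  move=> le; rewrite (val_iexp (hv l)); have [->|x0] := eqVneq x 0.
    by rewrite vt0; split => // _; left.
  rewrite vtE // leq_min le; split; [case=> // h|by right].
  by rewrite h eqxx in x0.
have vtD l x y : (minn (vt l x) (vt l y) <= vt l (x + y)%R)%N.
  have [[idP _ _] _ _] := hP l.
  have le : (minn (vt l x) (vt l y) <= e l)%N by rewrite geq_min vt_le.
  apply/vt_iexp => //; apply: (idealD (ideal_iexp _ idP)); apply/vt_iexp => //.
    exact: geq_minl.
  exact: geq_minr.
have vtK l x : K x -> vt l x = e l.
  move=> Kx; have [->|x0] := eqVneq x 0; first exact: vt0.
  by rewrite vtE //; apply/minn_idPl/(he l).2.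
have vt_sub B x : is_ideal B -> isub K B ->
    (forall l, exists2 y, B y & (vt l y <= vt l x)%N) -> B x.
  move=> idB KB h; rewrite -(mul1r x).
  (* Local-global argument: the colon ideal of [B] by [x] contains a denominator outside each [P l],
     hence contains [1]. *)
  pose C : iset D := fun d => B (d * x).
  have idC : is_ideal C.
    split; first by rewrite /C mul0r; exact: ideal0.
      by move=> a b; rewrite /C mulrDl; exact: idealD.
    by move=> a b; rewrite /C -mulrA; exact: idealMl.
  apply: (local_unit idC); first by move=> k /KB Bk; exact: idealMr.
  move=> l; have [x0|x0] := eqVneq x 0.
    by exists 1; [rewrite /C x0 mulr0; exact: ideal0|have [[]] := hP l].
  have [a [Ba a0 le]] : exists a, [/\ B a, a != 0 & (v l a <= v l x)%N].
    have [y By] := h l; rewrite (vtE l x) // leq_min => /andP [_ le].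
    have [lt|] := ltnP (vt l y) (e l).
      exists y; split => //; first by apply: contraTneq lt => ->; rewrite vt0 ltnn.
      suff -> : v l y = vt l y by [].
      have y0 : y != 0 by apply: contraTneq lt => ->; rewrite vt0 ltnn.
      by move: lt; rewrite vtE //; lia.
    (* At the cut-off, [y] may be zero or have larger valuation than [x]; an element of [K] of
       valuation exactly [e l] replaces it. *)
    move=> ge; have [[k [Kk k0 ek]] _] := he l; exists k; split; [exact: KB|by []|].
    by rewrite ek (leq_trans ge).
  have [s [w [Ps es]]] := val_frac (hv l) a0 x0 le.
  by exists s => //; rewrite /C es; exact: idealMl.
have vtX l c m : P l c -> (minn (e l) m <= vt l (c ^+ m))%N.
  move=> Pc; have [c0|c0] := eqVneq (c ^+ m) 0; first by rewrite c0 vt0 geq_minl.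
  rewrite vtE // leq_min geq_minl /=; apply: leq_trans (geq_minr _ _) _.
  by have := mem_iexp m Pc; move/(val_iexp (hv l)) => [] // c0'; rewrite c0' eqxx in c0.
have vtge l x : (e l <= vt l x)%N -> vt l x = e l.
  by move=> h; apply/eqP; rewrite eqn_leq vt_le.
pose U l : iset D := fun x => vt l x = e l.
have idU l : is_ideal (U l).
  split; first exact: vt0.
    move=> x y ex ey; apply: vtge; apply: leq_trans (vtD l x y).
    by rewrite ex ey minnn.
  by move=> a x ex; rewrite /U vtM ex; apply/minn_idPl; exact: leq_addl.
(* Idempotents for the Chinese remainder theorem. [U l] and the intersection [V] of the other [U m]
   are comaximal: at [P l] a product of powers of elements of the other primes is a unit, and at
   [P j] a power of an element of [P l] is one. *)
have /choice [d hd] : forall l, exists d, U l (d - 1) /\ forall m, m != l -> U m d.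
  move=> l; pose V : iset D := fun x => forall m, m != l -> U m x.
  have idV : is_ideal V.
    split; first by move=> m _; exact: vt0.
      by move=> x y hx hy m ml; apply: (idealD (idU m)); [exact: hx|exact: hy].
    by move=> a x hx m ml; apply: (idealMl _ (idU m)); exact: hx.
  suff [a [b [Ua Vb e1]]] : isum (U l) V 1.
    exists b; split => //; rewrite e1 opprD addrCA subrr addr0.
    exact: (idealN (idU l)).
  apply: local_unit.
  - exact: ideal_isum.
  - move=> x Kx; exists x, 0; rewrite addr0; split=> //; first exact: vtK.
    exact: ideal0.
  move=> j; have [pj _ _] := hP j; have [->|jl] := eqVneq j l.
    have /choice [c hc] : forall m, exists c, m != l -> P m c /\ ~ P l c.
      move=> m; have [->|ml] := eqVneq m l; first by exists 0.
      by have [c h1 h2] := distinct_primes_separated ml; exists c.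
    exists (\prod_(m | m != l) c m ^+ e m).
      exists 0, (\prod_(m | m != l) c m ^+ e m); rewrite add0r; split=> //.
      move=> m ml; rewrite (bigD1 m) //=; apply: (idealMr _ (idU m)).
      by apply: vtge; have := vtX m (c m) (e m) (hc m ml).1; rewrite minnn.
    have [pl _ _] := hP l; apply: prime_prod_notin => // m ml.
    exact: (prime_exp_notin pl (hc m ml).2).
  have [|c Pc Pjc] := @distinct_primes_separated l j; first by rewrite eq_sym.
  exists (c ^+ e l); last exact: (prime_exp_notin pj).
  exists (c ^+ e l), 0; rewrite addr0; split=> //; last exact: ideal0.
  by apply: vtge; have := vtX l c (e l) Pc; rewrite minnn.
have vt_crt (x : 'I_n -> D) : exists y, forall l, vt l (y - x l) = e l.
  exists (\sum_m d m * x m) => l; rewrite (bigD1 l) //= addrAC.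
  apply: (idealD (idU l)).
    rewrite -{2}(mul1r (x l)) -mulrBl; apply: (idealMr _ (idU l)); exact: (hd l).1.
  apply: ideal_sum => // m ml; apply: (idealMr _ (idU l)); apply: (hd m).2.
  by rewrite eq_sym.
have vt_congr l x y : vt l (x - y) = e l -> (vt l y <= vt l x)%N.
  move=> h; have := vtD l (x - y) y; rewrite subrK h.
  by rewrite (minn_idPr (vt_le _ _)).
have vt_exact (m : 'I_n -> nat) : (forall l, m l <= e l)%N ->
    exists x, forall l, vt l x = m l.
  move=> hm; have /choice [p hp] : forall l, exists p, vt l p = m l.
    move=> l; have [p p0 vp] := val_uniformizer (hv l).
    have vpX k : v l (p ^+ k) = k.
      elim: k => [|k IH]; last by rewrite exprS (valM (hv l)) ?expf_neq0 // IH vp.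
      by rewrite expr0; apply: v_notin; have [[]] := hP l.
    by exists (p ^+ m l); rewrite vtE ?expf_neq0 // vpX; apply/minn_idPr.
  have [y hy] := vt_crt p; exists y => l; apply/eqP; rewrite -hp eqn_leq.
  rewrite !vt_congr //; rewrite -opprB; exact: (idealN (idU l)).
exists e, vt; split => //.
  move=> x; split => [Kx l|h]; first exact: vtK.
  apply: vt_sub => // l; have [[k [Kk _ _]] _] := he l.
  by exists k => //; rewrite h.
move=> l m x; have [[idP _ _] _ _] := hP l; split => [[a [k [ha hk ->]]]|h].
  apply: leq_trans (vtD l a k); rewrite (vtK l k hk) leq_min geq_minr andbT.
  have [->|a0] := eqVneq a 0; first by rewrite vt0 geq_minr.
  rewrite vtE // minnC leq_min geq_minl /=; apply: leq_trans (geq_minr _ _) _.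
  by move/(val_iexp (hv l)): ha => [] // a0'; rewrite a0' eqxx in a0.
have [le|lt] := leqP m (e l).
  exists x, 0; rewrite addr0; split=> //; last exact: ideal0.
  by apply/vt_iexp => //; rewrite (minn_idPl le) in h.
(* For [m] beyond [e l] the sum is tested locally: at [P l] an element of [K] of valuation [e l]
   suffices, and at [P j] a power of an element of [P l] outside [P j] is a unit. *)
have idI := ideal_isum (ideal_iexp m idP) idK.
have subI : isub K (isum (iexp (P l) m) K).
  by move=> k Kk; exists 0, k; rewrite add0r; split=> //; exact: ideal0 (ideal_iexp m idP).
apply: vt_sub => // j; have [->|jl] := eqVneq j l.
  have [[k [Kk _ _]] _] := he l; exists k; first exact: subI.
  by rewrite vtK //; rewrite (minn_idPr (ltnW lt)) in h.
have [|c Pc Pjc] := @distinct_primes_separated l j; first by rewrite eq_sym.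
exists (c ^+ m).
  by exists (c ^+ m), 0; rewrite addr0; split=> //; [exact: mem_iexp|exact: ideal0].
have [pj _ _] := hP j.
by rewrite vt_notin //; exact: prime_exp_notin.
Qed.

End CutValuations.

(** * P-orderings *)

Section IdealProducts.
Variable D : idomainType.

Lemma ideal_iprod (T : Type) (s : seq T) (A : T -> iset D) :
  (forall i, is_ideal (A i)) -> is_ideal (iprod [seq A i | i <- s]).
Proof. by move=> hA; case: s => [|i s] //=; exact: ideal_imul. Qed.

Lemma mem_iprod (T : Type) (s : seq T) (A : T -> iset D) (y : T -> D) :
  (forall i, A i (y i)) -> iprod [seq A i | i <- s] (\prod_(i <- s) y i).
Proof.
by move=> h; elim: s => [|i s IH] //=; rewrite big_cons; exact: mem_imul.
Qed.

Lemma iprod_sub (T : eqType) (s : seq T) (A : T -> iset D) i :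
  (forall i, is_ideal (A i)) -> i \in s -> isub (iprod [seq A i | i <- s]) (A i).
Proof.
move=> hA; elim: s => [|j s IH] //=; rewrite inE => /orP [/eqP ->|/IH {}IH].
  by apply: imul_sub => // a b ha _; exact: idealMr.
by apply: imul_sub => // a b _ /IH; exact: idealMl.
Qed.

Lemma map_nth_enum (T : Type) (x0 : T) (s : seq T) :
  [seq nth x0 s (val l) | l <- enum 'I_(size s)] = s.
Proof. by rewrite (map_comp (nth x0 s)) val_enum_ord -/(mkseq _ _) mkseq_nth. Qed.

Lemma diffprod0 (b : nat -> D) x : diffprod b 0 x = 1.
Proof. exact: big_ord0. Qed.

Lemma diffprodS (b : nat -> D) k x : diffprod b k.+1 x = diffprod b k x * (x - b k).
Proof. exact: big_ord_recr. Qed.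

Lemma diffprod_eq0 (b : nat -> D) k j : (j < k)%N -> diffprod b k (b j) = 0.
Proof. by move=> lt; rewrite /diffprod (bigD1 (Ordinal lt)) //= subrr mul0r. Qed.

Lemma newton_expansion (b b' : nat -> D) k : exists c : nat -> D, c k = 1 /\
  forall x, diffprod b' k x = \sum_(j < k.+1) c j * diffprod b j x.
Proof.
elim: k => [|k [c [ck hc]]].
  by exists (fun=> 1); split=> // x; rewrite big_ord1 !diffprod0 mulr1.
(* Comes from [x - b' k = (x - b j) + (b j - b' k)]: the first summand shifts the index [j], the
   second keeps it. The test on [j] is there because [c] is unspecified beyond [k]. *)
pose c' j := (if j is j'.+1 then c j' else 0) +
             (if (j <= k)%N then c j * (b j - b' k) else 0).
exists c'; split; first by rewrite /c' ck ltnn addr0.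
move=> x; rewrite diffprodS hc mulr_suml.
transitivity (\sum_(j < k.+1) c j * diffprod b j.+1 x
              + \sum_(j < k.+1) c j * (b j - b' k) * diffprod b j x).
  by rewrite -big_split; apply: eq_bigr => j _ /=; rewrite diffprodS; ring.
have -> : \sum_(j < k.+2) c' j * diffprod b j x =
    \sum_(j < k.+2) (if (j : nat) is j'.+1 then c j' else 0) * diffprod b j x +
    \sum_(j < k.+2) (if (j <= k)%N then c j * (b j - b' k) else 0) * diffprod b j x.
  by rewrite -big_split; apply: eq_bigr => j _ /=; rewrite mulrDl.
congr (_ + _); first by rewrite [RHS]big_ord_recl mul0r add0r.
rewrite [RHS]big_ord_recr /= ltnn mul0r addr0.
by apply: eq_bigr => j _; rewrite -ltnS ltn_ord.
Qed.

End IdealProducts.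

Section Orderings.
Variables (D : idomainType) (K : iset D) (Ps : seq (iset D)).
Notation n := (size Ps).
Notation P l := (nth (@ifull D) Ps (nat_of_ord l)).
Variables (e : 'I_n -> nat) (vt : 'I_n -> D -> nat).
Hypothesis cv : cut_valuations K (fun l => P l) e vt.
Implicit Types l : 'I_n.
Hypothesis idK : is_ideal K.

Lemma cut_ge l x : (e l <= vt l x)%N -> vt l x = e l.
Proof. by move=> h; apply/eqP; rewrite eqn_leq (cv_le cv). Qed.

Lemma level_ideal l m : (m <= e l)%N -> is_ideal (fun x => m <= vt l x)%N.
Proof.
move=> le; split; first by rewrite (cv0 cv).
  by move=> x y hx hy; apply: leq_trans (cvD cv l x y); rewrite leq_min hx.
by move=> a x hx; rewrite (cvM cv) leq_min le (leq_trans hx) // leq_addl.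
Qed.

Lemma cut_congr l x y : vt l (x - y) = e l -> vt l x = vt l y.
Proof.
move=> h; have id := level_ideal (leqnn (e l)).
have le z w : (e l <= vt l (z - w))%N -> (vt l w <= vt l z)%N.
  move=> h'; have := cvD cv l (z - w) w; rewrite subrK.
  by rewrite (cut_ge h') (minn_idPr (cv_le cv l w)).
by apply/eqP; rewrite eqn_leq !le //; [rewrite h|apply: (idealBC id); rewrite h].
Qed.

Lemma cut_prod l (T : Type) (s : seq T) (Q : pred T) (F : T -> D) :
  vt l (\prod_(i <- s | Q i) F i) = minn (e l) (\sum_(i <- s | Q i) vt l (F i)).
Proof.
elim: s => [|i s IH]; first by rewrite !big_nil (cv1 cv) minn0.
rewrite !big_cons; case: (Q i) => //; rewrite (cvM cv) IH.
by move: (vt l (F i)) (\sum_(j <- s | Q j) _)%N (e l) => a b c; lia.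
Qed.

Lemma wP_le l a a' : isub (wP K (P l) a) (wP K (P l) a') -> (vt l a' <= vt l a)%N.
Proof.
case/(_ a); first by split.
move=> h1 h2; case: (classic (K a')) => [/h1 Ka|/h2 /(_ (vt l a'))].
  by rewrite ((cvK cv a).1 Ka) (cv_le cv).
by rewrite !(cv_iexp cv) (minn_idPl (cv_le cv _ _)); exact.
Qed.

Lemma mem_wP l a x : ~ K a -> wP K (P l) a x <-> (vt l a <= vt l x)%N.
Proof.
move=> Ka; split => [[_ /(_ Ka) /(_ (vt l a))]|h].
  by rewrite !(cv_iexp cv) (minn_idPl (cv_le cv _ _)); exact.
by split => // _ m; rewrite !(cv_iexp cv) => /leq_trans; exact.
Qed.

(* Linearizes inclusion of the ideals [w(a)]: [w(0) = 0] is strictly smaller than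
   the least power of the prime even though both have valuation [e l]. *)
Definition wP_rank l a : nat :=
  (vt l a + (if excluded_middle_informative (K a) then 1 else 0))%N.

Lemma wP_rank_sub l a a' : (wP_rank l a' <= wP_rank l a)%N ->
  isub (wP K (P l) a) (wP K (P l) a').
Proof.
rewrite /wP_rank; case: excluded_middle_informative => Ka'; last first.
  case: excluded_middle_informative => Ka le x.
    by move=> [/(_ Ka) Kx _]; apply/mem_wP; rewrite ?((cvK cv x).1 Kx) ?(cv_le cv).
  by move=> /(mem_wP _ _ Ka) le'; apply/mem_wP => //; move: le; rewrite !addn0 => /leq_trans; exact.
case: excluded_middle_informative => Ka le x; first by move=> [/(_ Ka) Kx _]; split.
by exfalso; move: le (cv_le cv l a); rewrite ((cvK cv a').1 Ka') /=; lia.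
Qed.

Lemma Pordering_exists l (X : seq D) x0 : x0 \in X ->
  exists b, is_Pordering K (P l) (fun x => x \in X) b.
Proof.
move=> Xx0; pose f (h : seq D) x := \prod_(y <- h) (x - y).
have /choice [next hnext] : forall h, exists x, x \in X /\
    forall y, y \in X -> (wP_rank l (f h x) <= wP_rank l (f h y))%N.
  move=> h; have [|m [[x [Xx ex]] hm]] :=
      @ex_least (fun m => exists x, x \in X /\ m = wP_rank l (f h x)).
    by exists (wP_rank l (f h x0)), x0.
  by exists x; split => // y Xy; rewrite -ex; apply: hm; exists y.
(* The recursion carries the whole list of earlier terms, on which each choice depends. *)
pose hist k := iter k (fun h => rcons h (next h)) [::].
pose b k := next (hist k).
have hE k : hist k = mkseq b k.
  by elim: k => [|k IH] //; rewrite mkseqS -IH.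
have fE k x : f (hist k) x = diffprod b k x.
  by rewrite hE /f big_map /diffprod -[in LHS](subn0 k) big_mkord.
exists b; split => [k|k _ x Xx]; first by have [] := hnext (hist k).
by apply: wP_rank_sub; rewrite -!fE; apply (hnext (hist k)).2.
Qed.

(** Rows are evaluation points, columns Newton polynomials. In row [k] the entries off the diagonal
    vanish at the cut-off unless [h] is smaller in the column; by induction on [h] those terms
    already have level [N], which leaves the diagonal one. *)
Lemma triangular_coef l N (B : finType) (h : B -> nat) (A : B -> B -> D)
    (M : B -> nat) (c : B -> D) : (N <= e l)%N ->
  (forall k k', k' != k -> (h k <= h k')%N -> vt l (A k k') = e l) ->
  (forall k k', (minn (e l) (M k') <= vt l (A k k'))%N) ->
  (forall k, vt l (A k k) = minn (e l) (M k)) ->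
  (forall k, (N <= vt l (\sum_k' c k' * A k k')%R)%N) ->
  forall k, (N <= vt l (c k) + M k)%N.
Proof.
move=> Ne h1 h2 h3 h4 k; have [m] := ubnP (h k); elim: m k => // m IH k lt.
have idL := level_ideal Ne.
have : (N <= vt l (c k * A k k))%N.
  have := h4 k; rewrite (bigD1 k) //= => hs.
  rewrite -[X in vt l X](addrK (\sum_(k' | k' != k) c k' * A k k')).
  apply: (idealB idL) => //; apply: (ideal_sum _ idL) => k' nk.
  rewrite (cvM cv) leq_min Ne /=.
  have [le|lt'] := leqP (h k) (h k'); first by rewrite h1 //; lia.
  by have := IH k' (leq_trans lt' lt); have := h2 k k'; lia.
by rewrite (cvM cv) h3; lia.
Qed.

(** Extremality of P-orderings: the Newton expansion of [diffprod b' k] along [b] has top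
    coefficient [1], so the triangular elimination bounds [N] by the level of the [k]-th diagonal
    entry. The points [b'] need not lie in [X]. *)
Lemma Pordering_monic l (X : D -> Prop) b b' k N :
  is_Pordering K (P l) X b -> (N <= e l)%N ->
  (forall x, X x -> (N <= vt l (diffprod b' k x))%N) ->
  (N <= vt l (diffprod b k (b k)))%N.
Proof.
move=> [hb1 hb2] Ne hN; have [c [ck hc]] := newton_expansion b b' k.
have lt : (k < k.+1)%N by [].
have := @triangular_coef l N 'I_k.+1 (fun j => j) (fun i j => diffprod b j (b i))
  (fun j => vt l (diffprod b j (b j))) (fun j => c j) Ne _ _ _ _ (Ordinal lt).
rewrite /= ck (cv1 cv) add0n; apply.
- move=> i j nji le; rewrite diffprod_eq0 ?(cv0 cv) //.
  by rewrite ltn_neqAle le andbT eq_sym; apply: contraNneq nji => /val_inj ->.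
- move=> i j; rewrite (minn_idPr (cv_le cv _ _)).
  case: (posnP j) => [->|j0]; first by rewrite !diffprod0.
  by apply: wP_le; exact: hb2.
- by move=> j; rewrite (minn_idPr (cv_le cv _ _)).
- by move=> i; rewrite -hc; exact: hN.
Qed.

Lemma Pordering_min l (X : D -> Prop) b k x : is_Pordering K (P l) X b -> X x ->
  (vt l (diffprod b k (b k)) <= vt l (diffprod b k x))%N.
Proof.
move=> [_ hb] Xx; case: k => [|k]; first by rewrite !diffprod0.
by apply: wP_le; exact: hb.
Qed.

Lemma Pordering_unique l (X : D -> Prop) b b' k :
  is_Pordering K (P l) X b -> is_Pordering K (P l) X b' ->
  vt l (diffprod b k (b k)) = vt l (diffprod b' k (b' k)).
Proof.
have le b1 b2 : is_Pordering K (P l) X b1 -> is_Pordering K (P l) X b2 ->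
    (vt l (diffprod b1 k (b1 k)) <= vt l (diffprod b2 k (b2 k)))%N.
  move=> h1 h2; apply: (Pordering_monic (b' := b1) h2 (cv_le cv _ _)) => x Xx.
  exact: (Pordering_min k h1 Xx).
by move=> h1 h2; apply/eqP; rewrite eqn_leq !le.
Qed.

Lemma vkP_spec l (X : D -> Prop) b k : (0 < k)%N -> is_Pordering K (P l) X b ->
  exists b', is_Pordering K (P l) X b' /\
             vkP K (P l) X k = wP K (P l) (diffprod b' k (b' k)).
Proof.
case: k => // k _ hb; apply: (epsilon_spec (inhabits (@ifull D)) (fun I0 : iset D =>
  exists b', is_Pordering K (P l) X b' /\ I0 = wP K (P l) (diffprod b' k.+1 (b' k.+1)))).
by exists (wP K (P l) (diffprod b k.+1 (b k.+1))), b.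
Qed.

Lemma mem_vk (X : seq D) x0 (b : 'I_n -> nat -> D) k x :
  x0 \in X -> (forall l, is_Pordering K (P l) (fun x => x \in X) (b l)) ->
  vk K Ps (fun x => x \in X) k x <->
  forall l, (vt l (diffprod (b l) k (b l k)) <= vt l x)%N.
Proof.
move=> Xx0 hb; pose m l := vt l (diffprod (b l) k (b l k)).
set A := fun l : 'I_n => vkP K (P l) (fun x => x \in X) k.
have vkE : vk K Ps (fun x => x \in X) k = isum (iprod [seq A l | l <- enum 'I_n]) K.
  by rewrite /vk -{1}(map_nth_enum (@ifull D) Ps) -map_comp.
have hm0 : k = 0%N -> forall l, m l = 0%N.
  by move=> k0 l; rewrite /m k0 diffprod0 (cv1 cv).
have hA l : (0 < k)%N -> exists b', is_Pordering K (P l) (fun x => x \in X) b' /\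
    A l = wP K (P l) (diffprod b' k (b' k)).
  by move=> k0; exact: vkP_spec k0 (hb l).
(* If some factor of [v_k] is the zero ideal of [D / K], then a monic polynomial
   of degree [k] vanishes on [X] modulo [K], and every [m j] is maximal.  So the
   convention [w(0) = 0] does not affect the product. *)
have hA' : (forall l, m l = e l) \/ forall l y, A l y <-> (m l <= vt l y)%N.
  have [k0|k0] := posnP k.
    by right=> l y; rewrite hm0 // /A k0.
  case: (classic (exists l b', is_Pordering K (P l) (fun x => x \in X) b' /\
                               K (diffprod b' k (b' k)))) => [[l [b' [hb' Kb']]]|hno].
    left=> j; apply: cut_ge; apply: (Pordering_monic (b' := b') (hb j)) => // z Xz.
    have := hb'.2 k k0 z Xz (diffprod b' k z) (conj id (fun _ _ => id)).
    by case=> /(_ Kb')/(cvK cv) ->.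
  right=> l y; have [b' [hb' ->]] := hA l k0.
  rewrite mem_wP; first by rewrite /m (Pordering_unique k (hb l) hb').
  by move=> Kb'; apply: hno; exists l, b'.
have idA l : is_ideal (A l).
  have [k0|k0] := posnP k; first by rewrite /A k0.
  have [b' [_ ->]] := hA l k0.
  case: (classic (K (diffprod b' k (b' k)))) => Kb.
    have eK y : wP K (P l) (diffprod b' k (b' k)) y <-> K y.
      by split=> [[h _]|Ky]; [exact: h|split].
    by split=> [|u w /eK h1 /eK h2|u w /eK h]; apply/eK;
      [exact: ideal0|exact: idealD|exact: idealMl].
  have eL y := mem_wP l y Kb; have idL := level_ideal (cv_le cv l (diffprod b' k (b' k))).
  by split=> [|u w /eL h1 /eL h2|u w /eL h]; apply/eL;
    [exact: (ideal0 idL)|exact: (idealD idL)|exact: (idealMl _ idL)].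
have A_le l y : A l y -> (m l <= vt l y)%N.
  have [k0|k0] := posnP k; first by rewrite hm0.
  have [b' [hb' ->]] := hA l k0.
  rewrite /m (Pordering_unique k (hb l) hb') => h.
  case: (classic (K (diffprod b' k (b' k)))) => [Kb|Kb]; last exact/(mem_wP l y Kb).
  by case: h => /(_ Kb) Ky _; rewrite ((cvK cv y).1 Ky) (cv_le cv).
have idvk := ideal_isum (ideal_iprod (enum 'I_n) idA) idK.
have Kvk : isub K (isum (iprod [seq A l | l <- enum 'I_n]) K).
  move=> y Ky; exists 0, y; rewrite add0r; split=> //.
  exact: ideal0 (ideal_iprod (enum 'I_n) idA).
rewrite vkE; split=> [[a [y [ha Ky ->]]] l|h].
  apply: leq_trans (cvD cv l a y); rewrite ((cvK cv y).1 Ky) leq_min (cv_le cv) andbT.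
  by apply: A_le; apply: (iprod_sub idA _ ha); rewrite mem_enum.
case: hA' => [me|hA'].
  by apply: Kvk; apply/(cvK cv) => l; apply: cut_ge; rewrite -me; exact: h.
(* Each [y l] generates [A l] locally at [P l] and is a unit at the other primes, so the product of
   all of them attains every level [m l] at once. *)
have /choice [y hy] : forall l, exists y, forall j, vt j y = if j == l then m l else 0%N.
  move=> l; apply: (cv_exact cv) => j; case: eqP => // ->; exact: (cv_le cv).
apply: (cv_sub cv idvk Kvk) => l; exists (\prod_(j <- enum 'I_n) y j).
  exists (\prod_(j <- enum 'I_n) y j), 0; rewrite addr0; split=> //; last exact: ideal0.
  by apply: mem_iprod => j; apply/hA'; rewrite hy eqxx.
apply: leq_trans (h l); rewrite big_enum cut_prod (bigD1 l) //= hy eqxx big1 ?addn0 ?geq_minr //.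
by move=> j /negPf nj; rewrite hy eq_sym nj.
Qed.

(** The glued sequence [b] agrees with the [l]-th ordering up to the cut-off at [P l], but may leave
    [X]; evaluation therefore uses the points [beta l k] of [X], one sequence for each prime. *)
Lemma simultaneous_ordering (X : seq D) x0 : x0 \in X ->
  exists (b : nat -> D) (beta : 'I_n -> nat -> D) (m : 'I_n -> nat -> nat),
  [/\ forall l k, beta l k \in X,
      forall l k x, x \in X -> (m l k <= vt l (diffprod b k x))%N,
      forall l k, vt l (diffprod b k (beta l k)) = m l k
    & forall l j k, (j < k)%N -> vt l (diffprod b k (beta l j)) = e l] /\
  (forall k x, vk K Ps (fun x => x \in X) k x <-> forall l, (m l k <= vt l x)%N) /\
  (forall l, m l (size X) = e l).
Proof.
move=> Xx0; have /choice [beta hbeta] := fun l => Pordering_exists l Xx0.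
have /choice [b hb] := fun j => cv_crt cv (fun l => beta l j).
pose m l k := vt l (diffprod (beta l) k (beta l k)).
have dE l k x : vt l (diffprod b k x) = vt l (diffprod (beta l) k x).
  rewrite /diffprod !cut_prod; congr minn; apply: eq_bigr => j _.
  apply: cut_congr; have -> : x - b j - (x - beta l j) = beta l j - b j by ring.
  apply: cut_ge; apply: (idealBC (level_ideal (leqnn (e l)))).
  by rewrite hb.
exists b, beta, m; split; [split|split].
- by move=> l k; have [] := hbeta l.
- by move=> l k x Xx; rewrite dE; apply: Pordering_min (hbeta l) Xx.
- by move=> l k; rewrite dE.
- by move=> l j k lt; rewrite dE diffprod_eq0 ?(cv0 cv).
- by move=> k x; apply: mem_vk Xx0 hbeta.
- move=> l; apply: cut_ge.
  (* The product over all elements of [X] vanishes on [X]. *)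
  apply: (Pordering_monic (b' := fun j => nth 0 X j) (hbeta l)) => // x Xx.
  have lt : (index x X < size X)%N by rewrite index_mem.
  by rewrite -[in diffprod _ _ x](nth_index 0 Xx) diffprod_eq0 ?(cv0 cv).
Qed.

Lemma ideal_levels B : is_ideal B -> isub K B -> exists j : 'I_n -> nat,
  (forall l, j l <= e l)%N /\ forall x, B x <-> forall l, (j l <= vt l x)%N.
Proof.
move=> idB KB.
have /choice [j hj] : forall l, exists m, (exists2 y, B y & m = vt l y) /\
    forall k, (exists2 y, B y & k = vt l y) -> (m <= k)%N.
  by move=> l; apply: ex_least; exists (vt l 0), 0 => //; exact: ideal0.
exists j; split=> [l|x]; first by have [[y _ ->] _] := hj l; exact: cv_le cv l y.
split=> [Bx l|h]; first by apply: (hj l).2; exists x.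
by apply: (cv_sub cv idB KB) => l; have [[y By ey] _] := hj l; exists y; rewrite -?ey.
Qed.

Lemma iprod_level l (T : Type) (s : seq T) (A : T -> iset D) (m : T -> nat) x :
  (forall i y, A i y -> (m i <= vt l y)%N) -> iprod [seq A i | i <- s] x ->
  (minn (e l) (\sum_(i <- s) m i) <= vt l x)%N.
Proof.
move=> hA; elim: s x => [|i s IH] x; first by rewrite big_nil minn0.
have id := level_ideal (geq_minl (e l) (\sum_(j <- i :: s) m j)).
rewrite [iprod _]/=; move: x; apply: (imul_sub id) => a y /hA ha /IH hy.
rewrite (cvM cv) leq_min geq_minl /= big_cons.
by move: (\sum_(j <- s) m j)%N hy => M hy; lia.
Qed.

End Orderings.

(** * Counting polynomial functions *)

Section Classes.
Variables (T : Type) (E : T -> T -> Prop).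

Lemma has_nclasses_finType (Q : T -> Prop) (I : finType) (s : I -> T) :
  (forall i, Q (s i)) -> (forall i j, E (s i) (s j) -> i = j) ->
  (forall x, Q x -> exists i, E x (s i)) -> has_nclasses Q E #|I|.
Proof.
move=> h1 h2 h3; exists (fun i => s (enum_val i)); split=> //.
  by move=> i j /h2 /enum_val_inj.
by move=> x /h3 [i hi]; exists (enum_rank i); rewrite enum_rankK.
Qed.

(** Keeps the classes that meet [Q'] and chooses new representatives inside [Q']. *)
Lemma has_nclasses_subset (Q Q' : T -> Prop) n :
  (forall x y, E x y -> E y x) -> (forall x y z, E x y -> E y z -> E x z) ->
  (forall x, Q' x -> Q x) -> has_nclasses Q E n -> exists n', has_nclasses Q' E n'.
Proof.
move=> hsym htr sub [s [_ s2 s3]].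
pose S : {set 'I_n} := [set i | if excluded_middle_informative
  (exists2 x, Q' x & E x (s i)) then true else false].
have hS i : i \in S -> exists2 x, Q' x & E x (s i).
  by rewrite inE; case: excluded_middle_informative.
have /choice [t ht] : forall i : {i | i \in S}, exists x, Q' x /\ E x (s (val i)).
  by move=> i; have [x h1 h2] := hS _ (valP i); exists x.
exists #|{: {i | i \in S}}|; apply: (@has_nclasses_finType _ _ t).
- by move=> i; have [] := ht i.
- move=> i j Eij; apply/val_inj/s2.
  by apply: (htr _ _ _ (hsym _ _ (ht i).2)); exact: (htr _ _ _ Eij (ht j).2).
move=> x Qx; have [i hi] := s3 x (sub x Qx).
have iS : i \in S by rewrite inE; case: excluded_middle_informative => // -[]; exists x.
exists (exist _ i iS); apply: (htr _ _ _ hi); exact: (hsym _ _ (ht (exist _ i iS)).2).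
Qed.

End Classes.

(** Finiteness of [D / J] makes the number chosen by [epsilon] a true class count. *)
Lemma qcard_has_nclasses (D : idomainType) (A J : iset D) n :
  is_ideal J -> has_nclasses (@ifull D) (congr_mod J) n ->
  has_nclasses A (congr_mod J) (qcard A J).
Proof.
move=> idJ hn; apply: (epsilon_spec (inhabits 0%N)).
apply: (has_nclasses_subset _ _ _ hn) => //.
  by move=> x y; exact: idealBC.
by move=> x y z; exact: idealBT.
Qed.

(** * Functions given by polynomials in several variables *)

Section PolynomialMaps.
Variables (D : idomainType) (r : nat).
Implicit Types (f g : ('I_r -> D) -> D) (F G : mpoly D r).

Definition polynomial_map f := exists F, forall b, meval F b = f b.

Lemma polynomial_map_cst c : polynomial_map (fun=> c).
Proof.
exists [:: (c, [ffun=> 0%N])] => b; rewrite /meval big_seq1 /= big1 ?mulr1 //.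
by move=> i _; rewrite ffunE.
Qed.

Lemma polynomial_map_var i : polynomial_map (fun b => b i).
Proof.
exists [:: (1, [ffun j => (j == i) : nat])] => b.
rewrite /meval big_seq1 /= mul1r (bigD1 i) //= ffunE eqxx expr1 big1 ?mulr1 //.
by move=> j /negPf nj; rewrite ffunE nj.
Qed.

Lemma polynomial_mapD f g : polynomial_map f -> polynomial_map g ->
  polynomial_map (fun b => f b + g b).
Proof.
move=> [F hF] [G hG]; exists (F ++ G) => b.
by rewrite /meval big_cat -!/(meval _ b) hF hG.
Qed.

Lemma polynomial_mapM f g : polynomial_map f -> polynomial_map g ->
  polynomial_map (fun b => f b * g b).
Proof.
move=> [F hF] [G hG].
pose mul (t u : D * {ffun 'I_r -> nat}) := (t.1 * u.1, [ffun i => (t.2 i + u.2 i)%N]).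
exists [seq mul t u | t <- F, u <- G] => b.
rewrite -hF -hG /meval big_allpairs_dep mulr_suml; apply: eq_bigr => t _.
rewrite mulr_sumr; apply: eq_bigr => u _ /=.
under eq_bigr => i _ do rewrite ffunE exprD.
by rewrite big_split /=; ring.
Qed.

Lemma polynomial_map_sum (T : Type) (s : seq T) (f : T -> ('I_r -> D) -> D) :
  (forall i, polynomial_map (f i)) -> polynomial_map (fun b => \sum_(i <- s) f i b).
Proof.
move=> h; elim: s => [|i s [F hF]].
  by have [F hF] := polynomial_map_cst 0; exists F => b; rewrite hF big_nil.
have [G hG] := polynomial_mapD (h i) (ex_intro _ F hF).
by exists G => b; rewrite hG big_cons.
Qed.

Lemma polynomial_map_prod (T : Type) (s : seq T) (f : T -> ('I_r -> D) -> D) :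
  (forall i, polynomial_map (f i)) -> polynomial_map (fun b => \prod_(i <- s) f i b).
Proof.
move=> h; elim: s => [|i s [F hF]].
  by have [F hF] := polynomial_map_cst 1; exists F => b; rewrite hF big_nil.
have [G hG] := polynomial_mapM (h i) (ex_intro _ F hF).
by exists G => b; rewrite hG big_cons.
Qed.

Lemma polynomial_map_diffprod (b : nat -> D) k i :
  polynomial_map (fun x => diffprod b k (x i)).
Proof.
apply: (@polynomial_map_prod _ _ (fun (j : 'I_k) x => x i - b j)) => j.
exact: polynomial_mapD (polynomial_map_var i) (polynomial_map_cst _).
Qed.

End PolynomialMaps.

(** * Newton coefficients modulo [J] *)

Section Counting.
Variables (D : idomainType) (K : iset D) (Ps : seq (iset D)).
Notation n := (size Ps).
Variables (e : 'I_n -> nat) (vt : 'I_n -> D -> nat).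
Hypothesis cv : cut_valuations K (fun l : 'I_n => nth (@ifull D) Ps l) e vt.
Hypothesis idK : is_ideal K.
Variables (J : iset D) (jl : 'I_n -> nat).
Hypotheses (idJ : is_ideal J) (KJ : isub K J).
Hypothesis jl_le : forall l, (jl l <= e l)%N.
Hypothesis memJ : forall x, J x <-> forall l, (jl l <= vt l x)%N.
Variables (r : nat) (X : 'I_r -> seq D).
Variables (b : 'I_r -> nat -> D) (beta : 'I_r -> 'I_n -> nat -> D).
Variables (m : 'I_r -> 'I_n -> nat -> nat) (mu : 'I_r -> nat).
Hypothesis betaX : forall i l k, beta i l k \in X i.
Hypothesis m_le : forall i l k x, x \in X i -> (m i l k <= vt l (diffprod (b i) k x))%N.
Hypothesis m_beta : forall i l k, vt l (diffprod (b i) k (beta i l k)) = m i l k.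
Hypothesis beta_root : forall i l j k, (j < k)%N ->
  vt l (diffprod (b i) k (beta i l j)) = e l.
Hypothesis mu_gt0 : forall i, (0 < mu i)%N.
Hypothesis m_mu : forall i l, (jl l <= m i l (mu i))%N.

Notation box := {dffun forall i : 'I_r, 'I_(mu i)}.
Implicit Types (k : box) (x : 'I_r -> D).

Definition newton_term k x : D := \prod_i diffprod (b i) (k i) (x i).
Definition level l k : nat := (\sum_i m i l (k i))%N.
Definition in_grid x : Prop := forall i, x i \in X i.

Lemma newton_term_level l k x : in_grid x ->
  (minn (e l) (level l k) <= vt l (newton_term k x))%N.
Proof.
move=> hx; rewrite /newton_term (cut_prod cv) leq_min geq_minl /=.
apply: leq_trans (geq_minr _ _) _; apply: leq_sum => i _; exact: m_le.
Qed.

(** For each [l], evaluating at the points with coordinates [beta i l (k i)] gives a matrix that is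
    triangular for the total degree of [k]. *)
Lemma newton_combination_null (c : box -> D) :
  (forall x, in_grid x -> J (\sum_k c k * newton_term k x)) <->
  (forall k l, (jl l <= vt l (c k) + level l k)%N).
Proof.
split=> [h k l|h x hx].
  apply: (@triangular_coef D K Ps e vt cv l _ _ (fun k => \sum_i (k i : nat))%N
    (fun k k' => newton_term k' (fun i => beta i l (k i))) (level l) c (jl_le l)).
  - move=> {}k k' nk le.
    (* A different index of at least the same total degree exceeds [k] in some coordinate [i], where
       the factor vanishes at [beta i l (k i)]. *)
    have [i lt] : exists i, (k i < k' i)%N.
      apply: NNPP => hno; have hle i : (k' i <= k i)%N.
        by rewrite leqNgt; apply/negP => lt; apply: hno; exists i.
      have /eqP e1 : (\sum_i k' i == \sum_i k i)%N by rewrite eqn_leq le leq_sum.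
      case/eqP: nk; apply/ffunP => i; apply/val_inj/eqP => /=.
      rewrite eqn_leq hle /= leqNgt; apply/negP => lt.
      have : (\sum_i k' i < \sum_i k i)%N.
        rewrite (bigD1 i) // [X in (_ < X)%N](bigD1 i) //= -addSn leq_add //.
        by apply: leq_sum => j _; exact: hle.
      by rewrite e1 ltnn.
    rewrite /newton_term (cut_prod cv); apply/minn_idPl.
    by rewrite (bigD1 i) //= beta_root // leq_addr.
  - by move=> {}k k'; apply: newton_term_level => i; exact: betaX.
  - move=> {}k; rewrite /newton_term (cut_prod cv); congr minn.
    by apply: eq_bigr => i _; exact: m_beta.
  - by move=> {}k; have /memJ/(_ l) := h _ (fun i => betaX i l (k i)).
apply: ideal_sum => // k _; apply/memJ => l; rewrite (cvM cv) leq_min jl_le /=.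
by have := newton_term_level l k hx; have := h k l; have := jl_le l; lia.
Qed.

Definition newton_reducible (f : ('I_r -> D) -> D) : Prop :=
  exists c : box -> D, forall x, in_grid x -> J (f x - \sum_k c k * newton_term k x).

Lemma reducible_ext f g : (forall x, f x = g x) -> newton_reducible f -> newton_reducible g.
Proof. by move=> h [c hc]; exists c => x hx; rewrite -h; exact: hc. Qed.

Lemma reducible_null f : (forall x, in_grid x -> J (f x)) -> newton_reducible f.
Proof.
move=> h; exists (fun=> 0) => x hx; rewrite big1 ?subr0; first exact: h.
by move=> k _; rewrite mul0r.
Qed.

Lemma reducible_add f g : newton_reducible f -> newton_reducible g ->
  newton_reducible (fun x => f x + g x).
Proof.
move=> [c hc] [d hd]; exists (fun k => c k + d k) => x hx.
under eq_bigr => k _ do rewrite mulrDl.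
rewrite big_split opprD addrACA; apply: idealD => //; [exact: hc|exact: hd].
Qed.

Lemma reducible_scale a f : newton_reducible f -> newton_reducible (fun x => a * f x).
Proof.
move=> [c hc]; exists (fun k => a * c k) => x hx.
under eq_bigr => k _ do rewrite -mulrA.
by rewrite -mulr_sumr -mulrBr; apply: idealMl => //; exact: hc.
Qed.

Lemma reducible_sum (T : Type) (s : seq T) (f : T -> ('I_r -> D) -> D) :
  (forall t, newton_reducible (f t)) -> newton_reducible (fun x => \sum_(t <- s) f t x).
Proof.
move=> h; elim: s => [|t s IH].
  by apply: reducible_null => x _; rewrite big_nil; exact: ideal0.
apply: reducible_ext (reducible_add (h t) IH) => x; by rewrite big_cons.
Qed.

Lemma reducible_newton_term k : newton_reducible (newton_term k).
Proof.
exists (fun k' => (k' == k)%:R) => x hx.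
rewrite (bigD1 k) //= eqxx mul1r big1 ?addr0 ?subrr; first exact: ideal0.
by move=> k' /negPf ->; rewrite mul0r.
Qed.

Lemma reducible_one : newton_reducible (fun=> 1).
Proof.
apply: reducible_ext (reducible_newton_term [ffun i => Ordinal (mu_gt0 i)]) => x.
by rewrite /newton_term big1 // => i _; rewrite ffunE diffprod0.
Qed.

(** Writing [x i] as [(x i - b i (k i)) + b i (k i)] raises the [i]-th index by one. If that index
    reaches [mu i], the raised factor takes values in [J] on the grid. *)
Lemma reducible_var_newton_term i k :
  newton_reducible (fun x => x i * newton_term k x).
Proof.
pose succ x := diffprod (b i) (k i).+1 (x i) *
               \prod_(j | j != i) diffprod (b j) (k j) (x j).
apply: (@reducible_ext (fun x => succ x + b i (k i) * newton_term k x)).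
  move=> x; have -> : newton_term k x =
      diffprod (b i) (k i) (x i) * \prod_(j | j != i) diffprod (b j) (k j) (x j).
    by rewrite /newton_term (bigD1 i).
  by rewrite /succ diffprodS; ring.
apply: reducible_add; last exact/reducible_scale/reducible_newton_term.
have [lt|ge] := ltnP (k i).+1 (mu i).
  have hlt j : ((if j == i then (k j).+1 else k j) < mu j)%N.
    by case: eqP => [->|_].
  apply: reducible_ext (reducible_newton_term [ffun j => Ordinal (hlt j)]) => x.
  rewrite /newton_term (bigD1 i) //= ffunE /= eqxx; congr (_ * _).
  by apply: eq_bigr => j /negPf nj; rewrite ffunE /= nj.
have ek : (k i).+1 = mu i by apply/eqP; rewrite eqn_leq ge ltn_ord.
apply: reducible_null => x hx; apply: idealMr => //; rewrite ek.
by apply/memJ => l; apply: leq_trans (m_le l (mu i) (hx i)); exact: m_mu.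
Qed.

Lemma reducible_var i f : newton_reducible f -> newton_reducible (fun x => x i * f x).
Proof.
move=> [c hc].
have [d hd] : newton_reducible (fun x => \sum_k c k * (x i * newton_term k x)).
  by apply: reducible_sum => k; exact/reducible_scale/reducible_var_newton_term.
exists d => x hx; apply: (idealBT idJ _ (hd x hx)).
under [X in _ - X]eq_bigr => k _ do rewrite mulrCA.
by rewrite -mulr_sumr -mulrBr; apply: idealMl => //; exact: hc.
Qed.

Lemma reducible_meval (F : mpoly D r) : newton_reducible (meval F).
Proof.
apply: reducible_sum => t; apply: reducible_scale.
elim: (index_enum _) => [|i s IH].
  by apply: reducible_ext reducible_one => x; rewrite big_nil.
apply: (@reducible_ext (fun x => x i ^+ t.2 i * \prod_(j <- s) x j ^+ t.2 j)).
  by move=> x; rewrite big_cons.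
elim: (t.2 i) => [|a IHa]; first by apply: reducible_ext IH => x; rewrite mul1r.
by apply: reducible_ext (reducible_var i IHa) => x; rewrite exprS mulrA.
Qed.

(** The [k]-th Newton coefficient matters exactly modulo the colon ideal of [J] by [g k], and
    multiplication by [g k] identifies the quotient of [D] by it with [A k] modulo [J]. *)
Theorem count_polynomial_functions (A : box -> iset D) N :
  has_nclasses (@ifull D) (congr_mod J) N ->
  (forall k y, A k y <-> forall l, (minn (jl l) (level l k) <= vt l y)%N) ->
  has_nclasses (fun _ : mpoly D r => True) (same_polyfun X J)
    (\prod_(k : box) qcard (A k) J)%N.
Proof.
move=> hN hA; pose q k := qcard (A k) J.
(* An element attaining all the levels of [A k], so that [A k] is generated by [g k] and [J]. *)
have /choice [g hg] : forall k, exists g, forall l, vt l g = minn (jl l) (level l k).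
  by move=> k; apply: (cv_exact cv) => l; rewrite geq_min jl_le.
have Jg c k : J (c * g k) <-> forall l, (jl l <= vt l c + level l k)%N.
  rewrite memJ; split=> h l; have := h l; rewrite (cvM cv) hg.
    by lia.
  by have := jl_le l; lia.
have hq k : exists C : 'I_(q k) -> D, (forall j j', J ((C j - C j') * g k) -> j = j') /\
    forall c, exists j, J ((c - C j) * g k).
  have [s [s1 s2 s3]] := qcard_has_nclasses (A k) idJ hN.
  have Ak y : A k y -> exists c, J (y - c * g k).
    move=> Ay; have idB := ideal_isum (principal_ideal (g k)) idJ.
    have [] : isum (principal (g k)) J y.
      apply: (cv_sub cv idB).
        move=> z /KJ Jz; exists 0, z; rewrite add0r; split=> //.
        exact: ideal0 (principal_ideal _).
      move=> l; exists (g k); last by rewrite hg; exact: (hA k y).1 Ay l.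
      by exists (g k), 0; rewrite addr0; split=> //; [exists 1; rewrite mulr1|exact: ideal0].
    move=> _ [z [[c ->] Jz ->]]; exists c.
    by rewrite mulrC addrAC subrr add0r.
  have /choice [C hC] := fun j => Ak _ (s1 j).
  exists C; split=> [j j'|c].
    rewrite mulrBl => h; apply: s2; apply: (idealBT idJ (hC j)).
    by apply: (idealBT idJ h); exact: idealBC.
  have [|j hj] := s3 (c * g k).
    by apply/hA => l; rewrite (cvM cv) hg; have := jl_le l; lia.
  exists j; rewrite mulrBl; exact: (idealBT idJ hj).
(* The type of the representatives depends on [k] through [q k], hence a dependent choice. *)
pose C k := proj1_sig (constructive_indefinite_description _ (hq k)).
have C1 k j j' : J ((C k j - C k j') * g k) -> j = j'.
  by apply: (proj2_sig (constructive_indefinite_description _ (hq k))).1.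
have C2 k c : exists j, J ((c - C k j) * g k).
  by apply: (proj2_sig (constructive_indefinite_description _ (hq k))).2.
have diffE (c d : box -> D) x : \sum_k c k * newton_term k x - \sum_k d k * newton_term k x
    = \sum_k (c k - d k) * newton_term k x.
  by rewrite -sumrB; apply: eq_bigr => k _; rewrite mulrBl.
pose T : finType := {dffun forall k : box, 'I_(q k)}.
have /choice [F hF] : forall f : T, exists F : mpoly D r, forall x,
    meval F x = \sum_k C k (f k) * newton_term k x.
  move=> f; apply: polynomial_map_sum => k.
  apply: polynomial_mapM (polynomial_map_cst _ _) _.
  by apply: polynomial_map_prod => i; exact: polynomial_map_diffprod.
have -> : (\prod_(k : box) qcard (A k) J)%N = #|T|.
  rewrite card_dep_ffun foldrE big_map big_enum /=.
  by apply: eq_bigr => k _; rewrite card_ord.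
apply: (@has_nclasses_finType _ _ _ _ F) => //.
  move=> f f' h; apply/ffunP => k; apply: C1; apply/Jg.
  apply: (newton_combination_null (fun k => C k (f k) - C k (f' k))).1 => x hx.
  by rewrite -diffE -!hF; exact: h.
move=> G _; have [c hc] := reducible_meval G.
have /fin_all_exists [f hf] : forall k, exists j, J ((c k - C k j) * g k) by move=> k; exact: C2.
exists [ffun k => f k] => x hx; apply: (idealBT idJ (hc x hx)); rewrite hF diffE.
apply: (newton_combination_null (fun k => c k - C k ([ffun k => f k] k))).2 => // k.
by apply/Jg; rewrite ffunE.
Qed.

End Counting.

(** * The count for the given ideals *)

Lemma nth_In (T : Type) (x0 : T) (s : seq T) i : (i < size s)%N -> List.In (nth x0 s i) s.
Proof. by elim: s i => [|x s IH] [|i] //= lt; [left|right; exact: IH]. Qed.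

Lemma In_nth (T : Type) (x0 : T) (s : seq T) x : List.In x s ->
  exists2 i, (i < size s)%N & nth x0 s i = x.
Proof.
elim: s => [|y s IH] //= [->|/IH [i lt e]]; first by exists 0%N.
by exists i.+1.
Qed.

Theorem mainTheorem6 (D : idomainType) (r : nat) (I : 'I_r -> iset D) (J : iset D)
    (Ds : 'I_r -> seq D) (Ps : seq (iset D)) :
  dedekind D -> finite_norm D -> (0 < r)%N ->
  (forall i, [/\ is_ideal (I i), inonzero (I i) & iproper (I i)]) ->
  [/\ is_ideal J, inonzero J & iproper J] ->
  (forall i, residue_set (I i) (Ds i)) ->
  (* Ps lists the distinct nonzero primes containing K = I_1 ∩ ... ∩ I_r ∩ J *)
  (forall P, List.In P Ps ->
     [/\ prime_ideal P, inonzero P & isub (fun x => (forall i, I i x) /\ J x) P]) ->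
  (forall P, prime_ideal P -> inonzero P -> isub (fun x => (forall i, I i x) /\ J x) P ->
     exists2 Q, List.In Q Ps & ieq P Q) ->
  (forall l l', (l < size Ps)%N -> (l' < size Ps)%N ->
     ieq (nth (@ifull D) Ps l) (nth (@ifull D) Ps l') -> l = l') ->
  has_nclasses (fun _ : mpoly D r => True) (same_polyfun Ds J)
    (\prod_(k : {dffun forall i : 'I_r,
               'I_(mu_ideal (fun x => (forall i, I i x) /\ J x) Ps (fun x => x \in Ds i) (I i) J)})
       qcard (isum (isum (iprod [seq vk (fun x => (forall i, I i x) /\ J x) Ps
                                       (fun x => x \in Ds i) (k i) | i <- enum 'I_r])
                         (fun x => (forall i, I i x) /\ J x)) J) J)%N.
Proof.
move=> hD hfin r0 hI [idJ J0 J1] hDs hPs hcomp hdist.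
set K := fun x => (forall i, I i x) /\ J x.
have idI i : is_ideal (I i) by have [] := hI i.
have idK : is_ideal K.
  split; first by split=> [i|]; exact: ideal0.
    by move=> x y [h1 h2] [h3 h4]; split=> [i|]; [exact: (idealD (idI i))|exact: (idealD idJ)].
  by move=> a x [h1 h2]; split=> [i|]; [exact: (idealMl _ (idI i))|exact: (idealMl _ idJ)].
have KJ : isub K J by move=> x [].
have K0 : inonzero K.
  have [y [Jy y0]] := J0.
  have /fin_all_exists [x hx] : forall i, exists x, I i x /\ x != 0.
    by move=> i; have [_ [x h] _] := hI i; exists x.
  exists (y * \prod_i x i); split; last first.
    by rewrite mulf_neq0 //; apply/prodf_neq0 => i _; exact: (hx i).2.
  split=> [i|]; last exact: idealMr.
  by apply: (idealMl _ (idI i)); rewrite (bigD1 i) //=; apply: (idealMr _ (idI i)); exact: (hx i).1.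
have [|||e [vt cv]] := @cut_valuations_exist D K (size Ps)
    (fun l => nth (@ifull D) Ps l) hD hfin idK K0.
- by move=> l; apply: hPs; apply: nth_In; exact: ltn_ord.
- move=> Q h1 h2 h3; have [Q' /(In_nth (@ifull D)) [l lt <-] e] := hcomp Q h1 h2 h3.
  by exists (Ordinal lt).
- by move=> l l' ell; apply/val_inj/(hdist _ _ (ltn_ord l) (ltn_ord l') ell).
have [jl [jl_le memJ]] := ideal_levels cv idJ KJ.
have [N hN] := hfin J idJ J0.
have [D0 hord] : (forall i, 0 \in Ds i) /\ forall i, exists bbm : (nat -> D) *
    ('I_(size Ps) -> nat -> D) * ('I_(size Ps) -> nat -> nat),
  [/\ forall l k, bbm.1.2 l k \in Ds i,
      forall l k x, x \in Ds i -> (bbm.2 l k <= vt l (diffprod bbm.1.1 k x))%N,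
      forall l k, vt l (diffprod bbm.1.1 k (bbm.1.2 l k)) = bbm.2 l k
    & forall l j k, (j < k)%N -> vt l (diffprod bbm.1.1 k (bbm.1.2 l j)) = e l] /\
  (forall k x, vk K Ps (fun x => x \in Ds i) k x <-> forall l, (bbm.2 l k <= vt l x)%N) /\
  (forall l, bbm.2 l (size (Ds i)) = e l).
  have D0 i : 0 \in Ds i by have [] := hDs i.
  split=> // i; have [b [beta [m h]]] := simultaneous_ordering cv idK (D0 i).
  by exists (b, beta, m).
have {hord} /fin_all_exists [bbm hbbm] := hord.
pose b i := (bbm i).1.1; pose beta i := (bbm i).1.2; pose m i := (bbm i).2.
have mE i l k : (m i l k <= e l)%N.
  by have [[_ _ h _] _] := hbbm i; rewrite /m -h; exact: cv_le cv _ _.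
have memvk i k x : vk K Ps (fun x => x \in Ds i) k x <-> forall l, (m i l k <= vt l x)%N.
  by have [_ [h _]] := hbbm i; exact: h.
pose mu i := mu_ideal K Ps (fun x => x \in Ds i) (I i) J.
have hmu i : (0 < mu i)%N /\ isub (vk K Ps (fun x => x \in Ds i) (mu i)) J.
  (* At [k = size (Ds i)] every level is maximal, so [v_k] lies in [K] and the minimum defining
     [mu i] exists. *)
  have ex : exists k, (0 < k)%N /\ isub (vk K Ps (fun x => x \in Ds i) k) J.
    exists (size (Ds i)); split; first by case: (Ds i) (D0 i).
    move=> x /memvk h; apply/KJ/(cvK cv) => l; apply/eqP.
    have [_ [_ h']] := hbbm i; rewrite eqn_leq (cv_le cv) -h'; exact: h.
  have : exists k, ((exists k, (0 < k)%N /\ isub (vk K Ps (fun x => x \in Ds i) k) J) /\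
       [/\ (0 < k)%N, isub (vk K Ps (fun x => x \in Ds i) k) J &
           forall j, (0 < j)%N -> isub (vk K Ps (fun x => x \in Ds i) j) J -> (k <= j)%N])
      \/ (~ (exists k, (0 < k)%N /\ isub (vk K Ps (fun x => x \in Ds i) k) J) /\
          k = qcard (@ifull D) (I i)).
    have [k [[h1 h2] h3]] := ex_least ex.
    by exists k; left; split=> //; split=> // j h4 h5; apply: h3.
  by move/(epsilon_spec (inhabits 0%N)) => [[_ []]|[]].
have m_mu i l : (jl l <= m i l (mu i))%N.
  (* An element with exactly the levels of [v_k] at [k = mu i] belongs to it, hence to [J]. *)
  have [y hy] := cv_exact cv (fun l => mE i l (mu i)).
  rewrite -hy; move: l; apply/memJ; apply: (hmu i).2.
  by apply/memvk => l; rewrite hy.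
apply: (@count_polynomial_functions D K Ps e vt cv J jl idJ KJ jl_le memJ r Ds b beta m mu
  _ _ _ _ (fun i => (hmu i).1) m_mu _ N hN).
- by move=> i; have [[]] := hbbm i.
- by move=> i; have [[]] := hbbm i.
- by move=> i; have [[]] := hbbm i.
- by move=> i; have [[]] := hbbm i.
move=> k y; pose V i := vk K Ps (fun x => x \in Ds i) (k i).
have idV i : is_ideal (V i).
  have eV x : V i x <-> forall l, (m i l (k i) <= vt l x)%N := memvk i (k i) x.
  have idL l := level_ideal cv (mE i l (k i)).
  split; first by apply/eV => l; exact: (ideal0 (idL l)).
    by move=> x z /eV hx /eV hz; apply/eV => l; exact: (idealD (idL l)).
  by move=> a x /eV hx; apply/eV => l; exact: (idealMl _ (idL l)).
have idVs := ideal_iprod (enum 'I_r) idV.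
have idB := ideal_isum (ideal_isum idVs idK) idJ.
have levelE l : (\sum_(i <- enum 'I_r) m i l (k i))%N = level m l k.
  by rewrite /level big_enum.
split=> [[_ [j [[a [z [ha Kz ->]]] Jj ->]]] l|h].
  have hz := (cvK cv z).1 Kz l; have hj := (memJ j).1 Jj l.
  have := iprod_level cv (fun i y hy => (memvk i (k i) y).1 hy l) ha.
  rewrite levelE; have := cvD cv l a z; have := cvD cv l (a + z) j.
  by have := jl_le l; lia.
have VB x : iprod [seq V i | i <- enum 'I_r] x -> isum (isum (iprod [seq V i | i <- enum 'I_r]) K) J x.
  move=> hx; exists x, 0; rewrite addr0; split=> //; last exact: ideal0.
  by exists x, 0; rewrite addr0; split=> //; exact: ideal0.
have JB x : J x -> isum (isum (iprod [seq V i | i <- enum 'I_r]) K) J x.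
  by move=> hx; exists 0, x; rewrite add0r; split=> //; exact: ideal0 (ideal_isum idVs idK).
apply: (cv_sub cv idB) => [x /KJ|l]; first exact: JB.
(* The smaller of the two levels is attained by an element of [J] or by a product of elements of the
   [V i]. *)
have := h l; rewrite geq_min => /orP [le|le].
  have [w hw] := cv_exact cv jl_le; exists w; last by rewrite hw.
  by apply: JB; apply/memJ => l'; rewrite hw.
have /fin_all_exists [w hw] : forall i, exists w, forall l, vt l w = m i l (k i).
  by move=> i; apply: (cv_exact cv) => l'; exact: mE.
exists (\prod_(i <- enum 'I_r) w i).
  by apply: VB; apply: mem_iprod => i; apply/memvk => l'; rewrite hw.
apply: leq_trans le; rewrite (cut_prod cv) -levelE; apply: leq_trans (geq_minr _ _) _.
by apply: leq_sum => i _; rewrite hw.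
Qed.
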